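(* Let $\mathcal{C}$ be a Heyting pretopos with an (indexed) natural number object and a class $\mathcal{S}$ of small maps. If $\mathcal{C}$ has an (indexed) final $\mathcal{P}_s$-coalgebra $E:V\to\mathcal{P}_sV$, then this is a model for the theory $\mathbf{CZF}_0+\mathbf{AFA}$; that is, all axioms of $\mathbf{CZF}_0+\mathbf{AFA}$ hold in the internal logic of $\mathcal{C}$ when quantifiers range over $V$, $x\,\epsilon\,y$ is interpreted as $x\in E(y)$, and the constant $\omega$ is interpreted as a suitable global element $1\to V$.
   Context: An (indexed) natural number object in $\mathcal{C}$ is an object $\mathbb{N}$ with maps $0:1\to\mathbb{N}$, $s:\mathbb{N}\to\mathbb{N}$ such that for any $f:P\to Y$ and $t:P\times Y\to Y$ there is a unique $\bar f:P\times\mathbb{N}\to Y$ with $\bar f\circ\langle \mathrm{id},0\rangle=f$ and $\bar f\circ(\mathrm{id}\times s)=t\circ\langle p_1,\bar f\rangle$. A class $\mathcal{S}$ of arrows of $\mathcal{C}$ is a class of small maps if it satisfies: (S1) $\mathcal{S}$ contains identities and is closed under composition; (S2) $\mathcal{S}$ is stable under pullback along arbitrary maps; (S3) every diagonal $\Delta_C:C\to C\times C$ is in $\mathcal{S}$; (S4) if $e:C\to D$ is epi, $g:D\to A$, and $ge\in\mathcal{S}$, then $g\in\mathcal{S}$; (S5) if $f:C\to A$ and $g:D\to A$ are in $\mathcal{S}$, so is $[f,g]:C+D\to A$; (P1) for every object $C$ there is an object $\mathcal{P}_s(C)$ and a natural (in $I$) bijection between maps $I\to\mathcal{P}_s(C)$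 and small relations between $I$ and $C$, i.e. subobjects $R\rightarrowtail I\times C$ whose composite with the projection to $I$ is in $\mathcal{S}$; (I) $\mathbb{N}\to 1$ is in $\mathcal{S}$; (R) there is a universal small map $\pi:E\to U$ in $\mathcal{S}$: for every $f:A\to B$ in $\mathcal{S}$ there are an epi $q:B'\to B$ and a map $B'\to U$ such that the pullback of $f$ along $q$ is isomorphic over $B'$ to the pullback of $\pi$ along $B'\to U$. $C\mapsto\mathcal{P}_s(C)$ is a covariant functor via direct images, and $\in_C\subseteq\mathcal{P}_s(C)\times C$ denotes the small relation corresponding to $\mathrm{id}_{\mathcal{P}_s(C)}$ (membership). $\mathcal{S}$ induces classes of small maps on all slices, so that $\mathcal{P}_s$ is the component over $1$ of an indexed endofunctor with components $\mathcal{P}_s^I$ on $\mathcal{C}/I$. An indexed final $\mathcal{P}_s$-coalgebra is a $\mathcal{P}_s$-coalgebra $(V,E)$ such that $I^*(V,E)$ is a terminal $\mathcal{P}_s^I$-coalgebra for all $I$. $\mathbf{CZF}_0$ is the first-order theory with intuitionistic logic, a binary relation symbol $\epsilon$ and a constant $\omega$, with axioms the universal closures of: (Extensionality) $\forall x(x\,\epsilon\,a\leftrightarrow x\,\epsilon\,b)\to a=b$; (Pairing) $\exists t\forall z(z\,\epsilon\,t\leftrightarrow(z=x\lor z=y))$; (Union) $\exists t\forall z(z\,\epsilon\,t\leftrightarrow\exists y(z\,\epsilon\,y\land y\,\epsilon\,x))$; (Emptyset) $\exists x\forall z(z\,\epsilon\,x\leftrightarrow\bot)$; (Intersection) $\exists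 t\forall z(z\,\epsilon\,t\leftrightarrow(z\,\epsilon\,a\land z\,\epsilon\,b))$; (Replacement) $\forall x\,\epsilon\,a\,\exists!y\,\phi\to\exists z\forall y(y\,\epsilon\,z\leftrightarrow\exists x\,\epsilon\,a\,\phi)$, for all formulas $\phi$; (Infinity-1) $\emptyset\,\epsilon\,\omega\land\forall x\,\epsilon\,\omega\,(sx\,\epsilon\,\omega)$; (Infinity-2) $\psi(\emptyset)\land\forall x\,\epsilon\,\omega\,(\psi(x)\to\psi(sx))\to\forall x\,\epsilon\,\omega\,\psi(x)$, for all formulas $\psi$; where $\emptyset$ is the empty set and $sx=x\cup\{x\}$. (AFA) Every graph has a unique colouring. Here a graph is a pair of sets $(n,e)$ with $e\subseteq n\times n$, and a colouring of it is a function $c$ assigning to every $x\,\epsilon\,n$ a set $c(x)$ such that $c(x)=\{c(y)\mid(x,y)\,\epsilon\,e\}$; pairs and functions are encoded in the standard way in terms of $\epsilon$. *)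

(* Defs.v *)
From Corelib Require Import ssreflect.
From Stdlib Require Fin.

Set Implicit Arguments.
Unset Strict Implicit.
Unset Printing Implicit Defensive.

Declare Scope cat_scope.
Delimit Scope cat_scope with cat.
Local Open Scope cat_scope.

Record category := Category {
  obj :> Type;
  hom : obj -> obj -> Type;
  idm : forall A, hom A A;
  comp : forall A B C, hom B C -> hom A B -> hom A C;
  comp_idl : forall A B (f : hom A B), comp (idm B) f = f;
  comp_idr : forall A B (f : hom A B), comp f (idm A) = f;
  comp_assoc : forall A B C D (h : hom C D) (g : hom B C) (f : hom A B),
    comp h (comp g f) = comp (comp h g) f
}.
Arguments hom {_} A B.
Arguments idm {_} A.
Notation "g ∘ f" := (comp g f) (at level 40, left associativity) : cat_scope.

Section Arrows.
Context {C : category}.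
Implicit Types A B D P X : C.

Definition mono A B (m : hom A B) :=
  forall X (f g : hom X A), m ∘ f = m ∘ g -> f = g.

Definition epi A B (e : hom A B) :=
  forall X (f g : hom B X), f ∘ e = g ∘ e -> f = g.

Definition iso A B (f : hom A B) :=
  exists g : hom B A, g ∘ f = idm A /\ f ∘ g = idm B.

Definition regular_epi A B (e : hom A B) :=
  exists (R : C) (a b : hom R A), e ∘ a = e ∘ b /\
    forall X (h : hom A X), h ∘ a = h ∘ b -> exists! k : hom B X, k ∘ e = h.

(* The square  f ∘ p = g ∘ q  is a pullback. *)
Definition is_pullback P A B D
    (p : hom P A) (q : hom P B) (f : hom A D) (g : hom B D) :=
  f ∘ p = g ∘ q /\
  forall X (a : hom X A) (b : hom X B), f ∘ a = g ∘ b ->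
    exists! h : hom X P, p ∘ h = a /\ q ∘ h = b.

End Arrows.

Record lex_category := LexCategory {
  lex_cat :> category;
  one : lex_cat;
  bang : forall X : lex_cat, hom X one;
  bang_uniq : forall (X : lex_cat) (f : hom X one), f = bang X;
  prod : lex_cat -> lex_cat -> lex_cat;
  pr1 : forall A B, hom (prod A B) A;
  pr2 : forall A B, hom (prod A B) B;
  pair : forall X A B, hom X A -> hom X B -> hom X (prod A B);
  pr1_pair : forall X A B (f : hom X A) (g : hom X B), pr1 A B ∘ pair f g = f;
  pr2_pair : forall X A B (f : hom X A) (g : hom X B), pr2 A B ∘ pair f g = g;
  pair_uniq : forall X A B (h : hom X (prod A B)),
    h = pair (pr1 A B ∘ h) (pr2 A B ∘ h);
  eqz : forall A B : lex_cat, hom A B -> hom A B -> lex_cat;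
  eqz_arr : forall (A B : lex_cat) (f g : hom A B), hom (eqz f g) A;
  eqz_eq : forall (A B : lex_cat) (f g : hom A B),
    f ∘ eqz_arr f g = g ∘ eqz_arr f g;
  eqz_lift : forall (A B : lex_cat) (f g : hom A B) X (h : hom X A),
    f ∘ h = g ∘ h -> hom X (eqz f g);
  eqz_arr_lift : forall (A B : lex_cat) (f g : hom A B) X (h : hom X A)
    (e : f ∘ h = g ∘ h), eqz_arr f g ∘ eqz_lift e = h;
  eqz_mono : forall (A B : lex_cat) (f g : hom A B), mono (eqz_arr f g)
}.
Arguments one {_}.
Arguments bang {_} X.
Arguments pr1 {_ A B}.
Arguments pr2 {_ A B}.

Section Lex.
Context {C : lex_category}.
Implicit Types A B D I J X Y : C.

Definition pmap A B A' B' (f : hom A A') (g : hom B B') :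
    hom (prod A B) (prod A' B') := pair (f ∘ pr1) (g ∘ pr2).

Definition diag A : hom A (prod A A) := pair (idm A) (idm A).

Definition pb A B D (f : hom A D) (g : hom B D) : C := eqz (f ∘ pr1) (g ∘ pr2).
Definition pb1 A B D (f : hom A D) (g : hom B D) : hom (pb f g) A :=
  pr1 ∘ eqz_arr (f ∘ pr1) (g ∘ pr2).
Definition pb2 A B D (f : hom A D) (g : hom B D) : hom (pb f g) B :=
  pr2 ∘ eqz_arr (f ∘ pr1) (g ∘ pr2).

Lemma pair_ext X A B (f g : hom X (prod A B)) :
  pr1 ∘ f = pr1 ∘ g -> pr2 ∘ f = pr2 ∘ g -> f = g.
Proof. by move=> e1 e2; rewrite (pair_uniq f) (pair_uniq g) e1 e2. Qed.

Lemma pair_comp X Y A B (f : hom X A) (g : hom X B) (h : hom Y X) :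
  pair f g ∘ h = pair (f ∘ h) (g ∘ h).
Proof. by apply: pair_ext; rewrite comp_assoc !(pr1_pair, pr2_pair). Qed.

Lemma pmap_pair X A B A' B' (f : hom A A') (g : hom B B')
    (a : hom X A) (b : hom X B) : pmap f g ∘ pair a b = pair (f ∘ a) (g ∘ b).
Proof. by rewrite pair_comp -!comp_assoc pr1_pair pr2_pair. Qed.

Lemma eqz_lift_ex A B (f g : hom A B) X (h : hom X A) :
  f ∘ h = g ∘ h -> exists k, eqz_arr f g ∘ k = h.
Proof. by move=> e; exists (eqz_lift e); exact: eqz_arr_lift. Qed.

Lemma pb_is_pullback A B D (f : hom A D) (g : hom B D) :
  is_pullback (pb1 f g) (pb2 f g) f g.
Proof.
split; first by rewrite /pb1 /pb2 !comp_assoc; exact: eqz_eq.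
move=> X a b e.
have [k hk] : exists k, eqz_arr (f ∘ pr1) (g ∘ pr2) ∘ k = pair a b.
  by apply: eqz_lift_ex; rewrite -!comp_assoc pr1_pair pr2_pair.
exists k; split.
  by rewrite /pb1 /pb2 -!comp_assoc hk pr1_pair pr2_pair.
move=> k' [e1 e2]; apply: (@eqz_mono _ _ _ (f ∘ pr1) (g ∘ pr2)).
rewrite hk; apply: pair_ext; rewrite ?(pr1_pair, pr2_pair) comp_assoc.
- by rewrite -e1.
- by rewrite -e2.
Qed.

(* A subobject is represented by a monomorphism; equality of subobjects is
   mutual inclusion [sub_eq]. *)
Record sub X := Sub {
  sdom : C;
  sarr : hom sdom X;
  smono : mono sarr
}.

(* The generalized element [f] of [X] belongs to [R]. *)
Definition factors X J (f : hom J X) (R : sub X) :=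
  exists h : hom J (sdom R), sarr R ∘ h = f.

Definition sub_le X (R T : sub X) := factors (sarr R) T.
Definition sub_eq X (R T : sub X) := sub_le R T /\ sub_le T R.

Lemma idm_mono X : mono (idm X).
Proof. by move=> Y f g; rewrite !comp_idl. Qed.

Definition sub_top X : sub X := Sub (@idm_mono X).

Definition sub_eqz X Y (f g : hom X Y) : sub X := Sub (@eqz_mono C X Y f g).

Lemma pullback_mono P A B D (p : hom P A) (q : hom P B) (f : hom A D)
    (g : hom B D) : is_pullback p q f g -> mono g -> mono p.
Proof.
case=> sq univ mg Z a b e.
have e2 : q ∘ a = q ∘ b by apply: mg; rewrite !comp_assoc -sq -!comp_assoc e.
have sq' : f ∘ (p ∘ a) = g ∘ (q ∘ a) by rewrite !comp_assoc sq.
have [k [_ ku]] := univ _ _ _ sq'.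
by rewrite -(ku a) // -(ku b).
Qed.

Lemma pb1_mono X Y (f : hom Y X) (R : sub X) : mono (pb1 f (sarr R)).
Proof. exact: pullback_mono (pb_is_pullback _ _) (@smono _ R). Qed.

Definition sub_pull X Y (f : hom Y X) (R : sub X) : sub Y :=
  Sub (@pb1_mono X Y f R).

Lemma comp_mono A B D (g : hom B D) (f : hom A B) :
  mono g -> mono f -> mono (g ∘ f).
Proof.
by move=> mg mf X a b; rewrite -!comp_assoc => e; apply: mf; apply: mg.
Qed.

Definition sub_comp X Y (m : hom X Y) (mm : mono m) (R : sub X) : sub Y :=
  Sub (comp_mono mm (@smono X R)).

Definition sub_meet X (R T : sub X) : sub X :=
  sub_comp (@smono X R) (sub_pull (sarr R) T).

Lemma factors_comp X J J' (f : hom J X) (q : hom J' J) (R : sub X) :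
  factors f R -> factors (f ∘ q) R.
Proof. by case=> h <-; exists (h ∘ q); rewrite comp_assoc. Qed.

Lemma factors_le X J (f : hom J X) (R T : sub X) :
  sub_le R T -> factors f R -> factors f T.
Proof. by case=> k e [h <-]; exists (k ∘ h); rewrite comp_assoc e. Qed.

Lemma factors_pull X Y J (f : hom Y X) (g : hom J Y) (R : sub X) :
  factors g (sub_pull f R) <-> factors (f ∘ g) R.
Proof.
have [sq univ] := pb_is_pullback f (sarr R); split.
- case=> h <-; exists (pb2 f (sarr R) ∘ h) => /=.
  by rewrite (comp_assoc f) (comp_assoc (sarr R)) sq.
- case=> h e; have [k [[k1 _] _]] := univ _ _ _ (eq_sym e).
  by exists k.
Qed.

(* [R] is an equivalence relation on [X]: it is one on generalized elements. *)
Definition equiv_rel X (R : sub (prod X X)) :=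
  (forall J (a : hom J X), factors (pair a a) R) /\
  (forall J (a b : hom J X), factors (pair a b) R -> factors (pair b a) R) /\
  (forall J (a b c : hom J X),
     factors (pair a b) R -> factors (pair b c) R -> factors (pair a c) R).

Definition effective X (R : sub (prod X X)) :=
  exists (Q : C) (q : hom X Q), is_pullback (pr1 ∘ sarr R) (pr2 ∘ sarr R) q q.

End Lex.

(* A pretopos: a (Barr-)exact category with finite coproducts that are
   disjoint and stable under pullback. *)
Record pretopos := Pretopos {
  pt_lex :> lex_category;
  im : forall A B : pt_lex, hom A B -> pt_lex;
  im_epi : forall (A B : pt_lex) (f : hom A B), hom A (im f);
  im_mono : forall (A B : pt_lex) (f : hom A B), hom (im f) B;
  im_factor : forall (A B : pt_lex) (f : hom A B), im_mono f ∘ im_epi f = f;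
  im_epi_regular : forall (A B : pt_lex) (f : hom A B), regular_epi (im_epi f);
  im_mono_mono : forall (A B : pt_lex) (f : hom A B), mono (im_mono f);
  regular_epi_stable : forall (P A B D : pt_lex)
    (p : hom P A) (q : hom P B) (f : hom A D) (g : hom B D),
    is_pullback p q f g -> regular_epi g -> regular_epi p;
  equiv_rel_effective : forall (X : pt_lex) (R : sub (prod X X)),
    equiv_rel R -> effective R;
  zero : pt_lex;
  cobang : forall X : pt_lex, hom zero X;
  cobang_uniq : forall (X : pt_lex) (f : hom zero X), f = cobang X;
  coprod : pt_lex -> pt_lex -> pt_lex;
  inl : forall A B, hom A (coprod A B);
  inr : forall A B, hom B (coprod A B);
  copair : forall A B X, hom A X -> hom B X -> hom (coprod A B) X;
  copair_inl : forall A B X (f : hom A X) (g : hom B X),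
    copair f g ∘ inl A B = f;
  copair_inr : forall A B X (f : hom A X) (g : hom B X),
    copair f g ∘ inr A B = g;
  copair_uniq : forall A B X (h : hom (coprod A B) X),
    h = copair (h ∘ inl A B) (h ∘ inr A B);
  inl_mono : forall A B, mono (inl A B);
  inr_mono : forall A B, mono (inr A B);
  inl_inr_disjoint : forall A B,
    is_pullback (cobang A) (cobang B) (inl A B) (inr A B);
  zero_strict : forall (X : pt_lex) (f : hom X zero), iso f;
  coprod_stable : forall (A B Z ZA ZB : pt_lex) (f : hom Z (coprod A B))
    (iA : hom ZA Z) (pA : hom ZA A) (iB : hom ZB Z) (pB : hom ZB B),
    is_pullback iA pA f (inl A B) -> is_pullback iB pB f (inr A B) ->
    iso (copair iA iB)
}.
Arguments zero {_}.
Arguments cobang {_} X.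
Arguments inl {_ A B}.
Arguments inr {_ A B}.

Section Pretopos.
Context {C : pretopos}.
Implicit Types A B D J X Y : C.

Definition sub_im X Y (f : hom X Y) : sub Y := Sub (@im_mono_mono C X Y f).

(* Direct image of a subobject. *)
Definition sub_ex X Y (f : hom X Y) (R : sub X) : sub Y := sub_im (f ∘ sarr R).

Definition sub_bot X : sub X := sub_im (cobang X).

Definition sub_join X (R T : sub X) : sub X := sub_im (copair (sarr R) (sarr T)).

Lemma regular_epi_epi A B (e : hom A B) : regular_epi e -> epi e.
Proof.
case=> R [a [b [eab univ]]] X f g efg.
have [|k [_ ku]] := univ X (f ∘ e); first by rewrite -!comp_assoc eab.
by rewrite -(ku f) // -(ku g).
Qed.

Lemma factors_im X Y J (f : hom X Y) (b : hom J Y) :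
  factors b (sub_im f) ->
  exists (J' : C) (q : hom J' J) (a : hom J' X), epi q /\ f ∘ a = b ∘ q.
Proof.
case=> h eh; have pbq := pb_is_pullback h (im_epi f).
exists (pb h (im_epi f)), (pb1 h (im_epi f)), (pb2 h (im_epi f)); split.
  by apply: regular_epi_epi; apply: (regular_epi_stable pbq); exact: im_epi_regular.
rewrite -eh; move: (pb1 _ _) (pb2 _ _) pbq => p q [sq _].
have -> : f ∘ q = im_mono f ∘ im_epi f ∘ q by rewrite im_factor.
by rewrite -!comp_assoc /= sq.
Qed.

End Pretopos.

Record heyting_pretopos := HeytingPretopos {
  hp_pt :> pretopos;
  sub_all : forall X Y : hp_pt, hom X Y -> sub X -> sub Y;
  sub_all_adj : forall (X Y : hp_pt) (f : hom X Y) (T : sub Y) (R : sub X),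
    sub_le (sub_pull f T) R <-> sub_le T (sub_all f R)
}.

Definition sub_imp (C : heyting_pretopos) (X : C) (R T : sub X) : sub X :=
  sub_all (sarr R) (sub_pull (sarr R) T).

Record nno (C : lex_category) := Nno {
  nat_obj : C;
  nat_zero : hom one nat_obj;
  nat_succ : hom nat_obj nat_obj;
  nat_rec : forall (P Y : C) (f : hom P Y) (t : hom (prod P Y) Y),
    exists! h : hom (prod P nat_obj) Y,
      h ∘ pair (idm P) (nat_zero ∘ bang P) = f /\
      h ∘ pmap (idm P) nat_succ = t ∘ pair pr1 h
}.

Definition small_rel (C : lex_category) (S : forall A B : C, hom A B -> Prop)
    (I X : C) (R : sub (prod I X)) := S _ _ (pr1 ∘ sarr R).

Record small_maps (C : pretopos) (N : nno C) := SmallMaps {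
  small : forall A B : C, hom A B -> Prop;
  small_id : forall A, small (idm A);
  small_comp : forall (A B D : C) (g : hom B D) (f : hom A B),
    small g -> small f -> small (g ∘ f);
  small_pullback : forall (P A B D : C)
    (p : hom P A) (q : hom P B) (f : hom A D) (g : hom B D),
    is_pullback p q f g -> small g -> small p;
  small_diag : forall A : C, small (diag A);
  small_quotient : forall (A B D : C) (e : hom A B) (g : hom B D),
    epi e -> small (g ∘ e) -> small g;
  small_copair : forall (A B D : C) (f : hom A D) (g : hom B D),
    small f -> small g -> small (copair f g);
  (* the natural bijection between arrows I -> P_s(X) and small relations
     between I and X *)
  Ps : C -> C;
  rel_of : forall I X : C, hom I (Ps X) -> sub (prod I X);
  classify : forall (I X : C) (R : sub (prod I X)),
    small_rel small R -> hom I (Ps X);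
  rel_of_small : forall (I X : C) (k : hom I (Ps X)), small_rel small (rel_of k);
  rel_of_inj : forall (I X : C) (k k' : hom I (Ps X)),
    sub_eq (rel_of k) (rel_of k') -> k = k';
  rel_of_classify : forall (I X : C) (R : sub (prod I X)) (sR : small_rel small R),
    sub_eq (rel_of (classify sR)) R;
  rel_of_nat : forall (I J X : C) (k : hom I (Ps X)) (q : hom J I),
    sub_eq (rel_of (k ∘ q)) (sub_pull (pmap q (idm X)) (rel_of k));
  small_nat : small (bang (nat_obj N));
  small_univ : exists (T U : C) (p : hom T U), small p /\
    forall (A B : C) (f : hom A B), small f ->
      exists (B' : C) (q : hom B' B) (u : hom B' U)
        (i : hom (pb q f) (pb u p)),
        epi q /\ iso i /\ pb1 u p ∘ i = pb1 q f
}.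

Section SmallMaps.
Context {C : pretopos} {N : nno C} (S : small_maps N).
Implicit Types A B I J X Y : C.

Definition mem_rel X : sub (prod (Ps S X) X) := rel_of (idm (Ps S X)).

(* "y ∈ k" for generalized elements y of X and k of P_s(X). *)
Definition isin J X (k : hom J (Ps S X)) (y : hom J X) :=
  factors (pair k y) (mem_rel X).

Lemma rel_of_isin I J X (k : hom I (Ps S X)) (a : hom J I) (y : hom J X) :
  factors (pair a y) (rel_of k) <-> isin (k ∘ a) y.
Proof.
rewrite -{1}(comp_idl k).
have [h1 h2] := rel_of_nat (idm (Ps S X)) k.
have e : pmap k (idm X) ∘ pair a y = pair (k ∘ a) y by rewrite pmap_pair comp_idl.
split.
- by move/(factors_le h1)/factors_pull; rewrite e.
- by move=> h; apply: (factors_le h2); apply/factors_pull; rewrite e.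
Qed.

Lemma classify_isin I J X (R : sub (prod I X)) (sR : small_rel (@small _ _ S) R)
    (a : hom J I) (y : hom J X) :
  isin (classify sR ∘ a) y <-> factors (pair a y) R.
Proof.
have [h1 h2] := rel_of_classify sR.
rewrite -rel_of_isin; split; exact: factors_le.
Qed.

Lemma isin_comp J J' X (k : hom J (Ps S X)) (y : hom J X) (q : hom J' J) :
  isin k y -> isin (k ∘ q) (y ∘ q).
Proof. by rewrite /isin -pair_comp; exact: factors_comp. Qed.

Lemma Ps_ext J X (k k' : hom J (Ps S X)) :
  (forall J' (q : hom J' J) (y : hom J' X),
     isin (k ∘ q) y <-> isin (k' ∘ q) y) -> k = k'.
Proof.
have le (k1 k2 : hom J (Ps S X)) :
    (forall J' (q : hom J' J) (y : hom J' X),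
       isin (k1 ∘ q) y -> isin (k2 ∘ q) y) -> sub_le (rel_of k1) (rel_of k2).
  move=> h; rewrite /sub_le [sarr _]pair_uniq.
  apply: (proj2 (rel_of_isin _ _ _)); apply: h.
  apply: (proj1 (rel_of_isin _ _ _)); rewrite -pair_uniq.
  by exists (idm _); rewrite comp_idr.
by move=> h; apply: rel_of_inj; split; apply: le => J' q y; apply h.
Qed.

Definition image_rel X Y (h : hom X Y) : sub (prod (Ps S X) Y) :=
  sub_ex (pmap (idm (Ps S X)) h) (mem_rel X).

Lemma image_rel_small X Y (h : hom X Y) : small_rel (@small _ _ S) (image_rel h).
Proof.
apply: (small_quotient (e := im_epi (pmap (idm (Ps S X)) h ∘ sarr (mem_rel X)))).
  by apply: regular_epi_epi; exact: im_epi_regular.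
rewrite -comp_assoc /= im_factor comp_assoc pr1_pair comp_idl.
exact: rel_of_small.
Qed.

(* α ↦ { h(x) | x ∈ α } *)
Definition Ps_map X Y (h : hom X Y) : hom (Ps S X) (Ps S Y) :=
  classify (image_rel_small h).

Lemma Ps_map_isin J X Y (h : hom X Y) (k : hom J (Ps S X)) (y : hom J Y) :
  isin (Ps_map h ∘ k) y ->
  exists (J' : C) (q : hom J' J) (x : hom J' X),
    epi q /\ isin (k ∘ q) x /\ h ∘ x = y ∘ q.
Proof.
move/classify_isin/factors_im=> [J' [q [a [eq e]]]].
exists J', q, (pr2 ∘ (sarr (mem_rel X) ∘ a)); split => //.
move: e; rewrite -comp_assoc [sarr _ ∘ a]pair_uniq pmap_pair pair_comp => e.
have e1 := f_equal (comp pr1) e; have e2 := f_equal (comp pr2) e.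
rewrite !pr1_pair comp_idl in e1; rewrite !pr2_pair in e2.
split; last by rewrite pr2_pair.
by rewrite /isin -e1 pr2_pair -pair_uniq; exists a.
Qed.

Lemma eqz_small A B (f g : hom A B) : small S (eqz_arr f g).
Proof.
apply: (small_pullback (q := f ∘ eqz_arr f g) (f := pair f g) _ (small_diag S B)).
split; first by rewrite !pair_comp !comp_idl -eqz_eq.
move=> X a b e.
have e1 := f_equal (comp pr1) e; have e2 := f_equal (comp pr2) e.
rewrite !pair_comp !comp_idl !pr1_pair in e1.
rewrite !pair_comp !comp_idl !pr2_pair in e2.
have [|k hk] := @eqz_lift_ex C _ _ f g X a; first by rewrite e1 e2.
exists k; split; first by rewrite -comp_assoc hk.
by move=> k' [e3 _]; apply: (@eqz_mono C _ _ f g); rewrite hk e3.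
Qed.

(* { ((i, α), x) | x ∈ α, f(x) = i }, a relation between I × P_s(X) and X *)
Definition fiber_rel I X (f : hom X I) : sub (prod (prod I (Ps S X)) X) :=
  sub_meet (rel_of (pr2 : hom (prod I (Ps S X)) (Ps S X)))
           (sub_eqz (f ∘ pr2) (pr1 ∘ pr1)).

Lemma fiber_rel_small I X (f : hom X I) :
  small_rel (@small _ _ S) (fiber_rel f).
Proof.
rewrite /small_rel /= comp_assoc; apply: small_comp; first exact: rel_of_small.
exact: small_pullback (pb_is_pullback _ _) (eqz_small _ _).
Qed.

(* (i, α) ↦ { x ∈ α | f(x) = i } *)
Definition fiber_part I X (f : hom X I) : hom (prod I (Ps S X)) (Ps S X) :=
  classify (fiber_rel_small f).

(* P_s^I (f : X -> I) = { (i, α) | α a small subobject of the fibre f^{-1}(i) },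
   with its projection to I. *)
Definition PsI I X (f : hom X I) : C := eqz (fiber_part f) pr2.
Definition PsI_incl I X (f : hom X I) : hom (PsI f) (prod I (Ps S X)) :=
  eqz_arr (fiber_part f) pr2.
Definition PsI_proj I X (f : hom X I) : hom (PsI f) I := pr1 ∘ PsI_incl f.

Lemma fiber_part_isin I J X (f : hom X I) (a : hom J (prod I (Ps S X)))
    (x : hom J X) :
  isin (fiber_part f ∘ a) x <-> isin (pr2 ∘ a) x /\ f ∘ x = pr1 ∘ a.
Proof.
rewrite classify_isin -rel_of_isin; split.
- case=> h /= e; split.
    by rewrite -e -comp_assoc; eexists.
  have [sq _] := pb_is_pullback (sarr (rel_of (X:=X) pr2))
    (eqz_arr (f ∘ pr2) (pr1 ∘ pr1 : hom (prod (prod I (Ps S X)) X) I)).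
  move: e; rewrite sq -comp_assoc; set z := (z in eqz_arr _ _ ∘ z) => e.
  have := f_equal (fun g => g ∘ z) (eqz_eq (f ∘ pr2)
     (pr1 ∘ pr1 : hom (prod (prod I (Ps S X)) X) I)).
  by rewrite -!comp_assoc e pr1_pair pr2_pair.
- case=> [[h e] efx].
  have [_ univ] := pb_is_pullback (sarr (rel_of (X:=X) pr2))
    (eqz_arr (f ∘ pr2) (pr1 ∘ pr1 : hom (prod (prod I (Ps S X)) X) I)).
  have [|k hk] := @eqz_lift_ex C _ _ (f ∘ pr2)
     (pr1 ∘ pr1 : hom (prod (prod I (Ps S X)) X) I) _ (pair a x).
    by rewrite -!comp_assoc pr1_pair pr2_pair.
  have [|l [[l1 _] _]] := univ _ h k; first by rewrite e hk.
  by exists l; rewrite /= -comp_assoc l1.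
Qed.

(* Together with [PsI_universal_conv]: arrows J -> P_s^I(f) over I correspond
   to small relations in the slice C/I, i.e. to small relations between J and X
   contained in the fibre product of J and X over I. *)
Lemma PsI_universal I J X (f : hom X I) (a : hom J I) (R : sub (prod J X)) :
  small_rel (@small _ _ S) R ->
  f ∘ (pr2 ∘ sarr R) = a ∘ (pr1 ∘ sarr R) ->
  exists! k : hom J (PsI f),
    PsI_proj f ∘ k = a /\ sub_eq (rel_of (pr2 ∘ (PsI_incl f ∘ k))) R.
Proof.
move=> sR eR.
have [|k hk] := @eqz_lift_ex C _ _ (fiber_part f) pr2 J (pair a (classify sR)).
  apply: Ps_ext => J' q y; rewrite -!comp_assoc fiber_part_isin comp_assoc.
  rewrite pr2_pair comp_assoc pr1_pair; split=> [[] //|h]; split=> //.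
  have [z ez] := proj1 (classify_isin _ _ _) h.
  have e1 := f_equal (comp pr1) ez; have e2 := f_equal (comp pr2) ez.
  rewrite pr1_pair in e1; rewrite pr2_pair in e2.
  rewrite -e1 -e2 (comp_assoc pr2 (sarr R)) (comp_assoc pr1 (sarr R)).
  by rewrite (comp_assoc f) (comp_assoc a) eR.
exists k; split.
  rewrite /PsI_proj -comp_assoc /PsI_incl hk pr1_pair pr2_pair.
  by split=> //; exact: rel_of_classify.
move=> k' [e1 e2]; apply: (@eqz_mono C _ _ (fiber_part f) pr2).
rewrite hk; apply: pair_ext.
  by rewrite pr1_pair comp_assoc -e1.
rewrite pr2_pair; apply: rel_of_inj.
have [c1 c2] := rel_of_classify sR; have [d1 d2] := e2.
split; [exact: factors_le d2 c1|exact: factors_le c2 d1].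
Qed.

Lemma PsI_map_lands I X Y (f : hom X I) (g : hom Y I) (h : hom X Y) :
  g ∘ h = f ->
  fiber_part g ∘ (pmap (idm I) (Ps_map h) ∘ PsI_incl f) =
  pr2 ∘ (pmap (idm I) (Ps_map h) ∘ PsI_incl f).
Proof.
move=> ef; apply: Ps_ext => J q y; set a := PsI_incl f ∘ q.
have ea : fiber_part f ∘ a = pr2 ∘ a.
  by rewrite /a comp_assoc (comp_assoc pr2) /PsI_incl eqz_eq.
have eb : pmap (idm I) (Ps_map h) ∘ PsI_incl f ∘ q =
    pair (pr1 ∘ a) (Ps_map h ∘ (pr2 ∘ a)).
  by rewrite -comp_assoc /pmap pair_comp comp_idl -comp_assoc.
rewrite -(comp_assoc (fiber_part g)) -(comp_assoc pr2) eb.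
rewrite fiber_part_isin pr1_pair pr2_pair; split=> [[]//|hy]; split=> //.
have [J' [r [x [er [hx ex]]]]] := Ps_map_isin hy.
apply: er; rewrite -comp_assoc -ex comp_assoc ef -comp_assoc.
move: hx; rewrite -ea -comp_assoc => /(proj1 (fiber_part_isin _ _ _)) [_ ->].
by [].
Qed.

Lemma PsI_universal_conv I J X (f : hom X I) (k : hom J (PsI f)) :
  let R := rel_of (pr2 ∘ (PsI_incl f ∘ k)) in
  f ∘ (pr2 ∘ sarr R) = PsI_proj f ∘ k ∘ (pr1 ∘ sarr R).
Proof.
move=> R; have hR : isin (pr2 ∘ (PsI_incl f ∘ k) ∘ (pr1 ∘ sarr R)) (pr2 ∘ sarr R).
  apply: (proj1 (rel_of_isin _ _ _)); rewrite -pair_uniq.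
  by exists (idm _); rewrite comp_idr.
move: hR; rewrite (comp_assoc pr2) /PsI_incl -eqz_eq -!(comp_assoc (fiber_part f)).
move=> /(proj1 (fiber_part_isin _ _ _)) [_ ->].
by rewrite /PsI_proj !comp_assoc.
Qed.

(* The action of P_s^I on an arrow h : f -> g of C/I: (i, α) ↦ (i, P_s(h)(α)). *)
Definition PsI_map I X Y (f : hom X I) (g : hom Y I) (h : hom X Y)
    (e : g ∘ h = f) : hom (PsI f) (PsI g) :=
  eqz_lift (PsI_map_lands e).

(* { ((i, α), (i, x)) | x ∈ α } *)
Lemma cst_mono I X :
  mono (pair pr1 (pair (pr1 ∘ pr1) pr2) :
    hom (prod (prod I (Ps S X)) X) (prod (prod I (Ps S X)) (prod I X))).
Proof.
move=> J a b; rewrite !pair_comp => e.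
have e1 := f_equal (comp pr1) e; have e2 := f_equal (comp (pr2 ∘ pr2)) e.
rewrite !pr1_pair in e1; rewrite -!comp_assoc !pr2_pair in e2.
exact: pair_ext.
Qed.

Definition cst_rel I X : sub (prod (prod I (Ps S X)) (prod I X)) :=
  sub_comp (@cst_mono I X) (rel_of pr2).

Lemma cst_rel_small I X : small_rel (@small _ _ S) (cst_rel I X).
Proof. by rewrite /small_rel /= comp_assoc pr1_pair; exact: rel_of_small. Qed.

(* (i, α) ↦ {i} × α *)
Definition cst_part I X : hom (prod I (Ps S X)) (Ps S (prod I X)) :=
  classify (cst_rel_small I X).

Lemma PsI_cst_lands I X :
  fiber_part (pr1 : hom (prod I X) I) ∘ pair pr1 (cst_part I X) =
  pr2 ∘ pair pr1 (cst_part I X).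
Proof.
apply: Ps_ext => J q y.
rewrite -!comp_assoc fiber_part_isin !pair_comp !(pr1_pair, pr2_pair).
split=> [[]//|hy]; split=> //.
have [z /= ez] := proj1 (classify_isin _ _ _) hy.
have e1 := f_equal (comp pr1) ez; have e2 := f_equal (comp (pr1 ∘ pr2)) ez.
rewrite !pair_comp !pr1_pair in e1.
rewrite !pair_comp -!comp_assoc !pr2_pair !pr1_pair in e2.
by rewrite -e2 -e1 !comp_assoc.
Qed.

(* The canonical isomorphism I^*(P_s X) ≅ P_s^I(I^*X). *)
Definition PsI_cst I X : hom (prod I (Ps S X)) (PsI (pr1 : hom (prod I X) I)) :=
  eqz_lift (PsI_cst_lands I X).

(* A P_s^I-coalgebra: an object of C/I with an arrow of C/I to its image
   under P_s^I. *)
Record coalgebra I := Coalgebra {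
  co_dom : C;
  co_proj : hom co_dom I;
  co_str : hom co_dom (PsI co_proj);
  co_over : PsI_proj co_proj ∘ co_str = co_proj
}.

Definition coalgebra_mor I (K L : coalgebra I) (h : hom (co_dom K) (co_dom L)) :=
  exists e : co_proj L ∘ h = co_proj K,
    co_str L ∘ h = PsI_map e ∘ co_str K.

Definition terminal_coalgebra I (L : coalgebra I) :=
  forall K : coalgebra I,
    exists! h : hom (co_dom K) (co_dom L), coalgebra_mor h.

Lemma cst_coalgebra_over I V (E : hom V (Ps S V)) :
  PsI_proj (pr1 : hom (prod I V) I) ∘ (PsI_cst I V ∘ pmap (idm I) E) = pr1.
Proof.
rewrite comp_assoc /PsI_proj -(comp_assoc pr1) /PsI_incl eqz_arr_lift.
by rewrite pr1_pair pr1_pair comp_idl.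
Qed.

Definition cst_coalgebra I V (E : hom V (Ps S V)) : coalgebra I :=
  Coalgebra (@cst_coalgebra_over I V E).

Definition indexed_final_coalgebra V (E : hom V (Ps S V)) :=
  forall I, terminal_coalgebra (cst_coalgebra I E).

End SmallMaps.

Declare Scope form_scope.
Delimit Scope form_scope with form.
Local Open Scope form_scope.

(* De Bruijn syntax: [form n] has its free variables in [Fin.t n], and
   [Fin.F1] is the most recently bound variable. *)
Inductive term (n : nat) : Type :=
| Var (i : Fin.t n)
| Omega.
Arguments Omega {n}.

Inductive form : nat -> Type :=
| Bot n : form n
| Mem n (s t : term n) : form n
| Eqn n (s t : term n) : form n
| And n (p q : form n) : form n
| Or n (p q : form n) : form n
| Imp n (p q : form n) : form n
| All n (p : form (S n)) : form n
| Ex n (p : form (S n)) : form n.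
Arguments Bot {n}.

Notation "s ∈ t" := (Mem s t) (at level 70) : form_scope.
Notation "s ≐ t" := (Eqn s t) (at level 70) : form_scope.
Notation "p ∧ q" := (And p q) (at level 80, right associativity) : form_scope.
Notation "p ∨ q" := (Or p q) (at level 85, right associativity) : form_scope.
Notation "p ⇒ q" := (Imp p q) (at level 90, right associativity) : form_scope.
Definition Iff n (p q : form n) : form n := (p ⇒ q) ∧ (q ⇒ p).
Notation "p ⇔ q" := (Iff p q) (at level 95, no associativity) : form_scope.

Notation v0 := (Var Fin.F1).
Notation v1 := (Var (Fin.FS Fin.F1)).
Notation v2 := (Var (Fin.FS (Fin.FS Fin.F1))).
Notation v3 := (Var (Fin.FS (Fin.FS (Fin.FS Fin.F1)))).

(* [fcons j r] maps the newest variable to [j] and is [r] on the others. *)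
Definition fcons n m (j : Fin.t m) (r : Fin.t n -> Fin.t m) (i : Fin.t (S n)) :
  Fin.t m := Fin.caseS' i (fun _ => Fin.t m) j r.

Definition flift n m (r : Fin.t n -> Fin.t m) : Fin.t (S n) -> Fin.t (S m) :=
  fcons Fin.F1 (fun i => Fin.FS (r i)).

Definition tren n m (r : Fin.t n -> Fin.t m) (t : term n) : term m :=
  match t with Var i => Var (r i) | Omega => Omega end.

Fixpoint ren n (p : form n) : forall m, (Fin.t n -> Fin.t m) -> form m :=
  match p in form n return forall m, (Fin.t n -> Fin.t m) -> form m with
  | Bot => fun m r => Bot
  | s ∈ t => fun m r => tren r s ∈ tren r t
  | s ≐ t => fun m r => tren r s ≐ tren r t
  | p ∧ q => fun m r => ren p r ∧ ren q r
  | p ∨ q => fun m r => ren p r ∨ ren q r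
  | p ⇒ q => fun m r => ren p r ⇒ ren q r
  | All p => fun m r => All (ren p (flift r))
  | Ex p => fun m r => Ex (ren p (flift r))
  end.

Definition up n (t : term n) : term (S n) := tren Fin.FS t.

Fixpoint close n : form n -> form 0 :=
  match n with
  | 0 => fun p => p
  | S m => fun p => close (All p)
  end.

Section Macros.
Context {n : nat}.
Implicit Types t x y : term n.

Definition AllIn t (p : form (S n)) : form n := All (v0 ∈ up t ⇒ p).
Definition ExIn t (p : form (S n)) : form n := Ex (v0 ∈ up t ∧ p).

(* ∃y (p(y) ∧ ∀y' (p(y') → y' = y)) *)
Definition ExU (p : form (S n)) : form n :=
  Ex (p ∧ All (ren p (flift Fin.FS) ⇒ v0 ≐ v1)).

Definition is_empty t : form n := All (v0 ∈ up t ⇔ Bot).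
(* t = x ∪ {x} *)
Definition is_succ t x : form n := All (v0 ∈ up t ⇔ v0 ∈ up x ∨ v0 ≐ up x).
(* t = {x, y} *)
Definition is_upair t x y : form n :=
  All (v0 ∈ up t ⇔ v0 ≐ up x ∨ v0 ≐ up y).
End Macros.

(* t = (x, y), the Kuratowski pair {{x}, {x, y}} *)
Definition is_opair n (t x y : term n) : form n :=
  All (v0 ∈ up t ⇔ is_upair v0 (up x) (up x) ∨ is_upair v0 (up x) (up y)).

(* (x, y) ∈ t *)
Definition opair_in n (x y t : term n) : form n :=
  Ex (is_opair v0 (up x) (up y) ∧ v0 ∈ up t).

(* context: a b *)
Definition Extensionality : form 0 :=
  close (n := 2) (All (v0 ∈ v2 ⇔ v0 ∈ v1) ⇒ v1 ≐ v0).

(* context: x y; then t, z *)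
Definition Pairing : form 0 :=
  close (n := 2) (Ex (All (v0 ∈ v1 ⇔ v0 ≐ v3 ∨ v0 ≐ v2))).

(* context: x; then t, z, y *)
Definition Union : form 0 :=
  close (n := 1) (Ex (All (v0 ∈ v1 ⇔ Ex (v1 ∈ v0 ∧ v0 ∈ v3)))).

Definition Emptyset : form 0 := Ex (All (v0 ∈ v1 ⇔ Bot)).

(* context: a b; then t, z *)
Definition Intersection : form 0 :=
  close (n := 2) (Ex (All (v0 ∈ v1 ⇔ v0 ∈ v3 ∧ v0 ∈ v2))).

(* context: parameters and a; [p] is φ in the context extended with x, y.
   The conclusion binds z, y, x, in this order. *)
Definition Replacement n (p : form (S (S (S n)))) : form 0 :=
  close (n := S n)
    (AllIn v0 (ExU p) ⇒
     Ex (All (v0 ∈ v1 ⇔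
       ExIn v2 (ren p (fcons (Fin.FS Fin.F1) (fcons Fin.F1
                        (fun i => Fin.FS (Fin.FS (Fin.FS i))))))))).

(* ∅ and sx are eliminated by ∅ ∈ ω := ∃z (z = ∅ ∧ z ∈ ω), etc. *)
Definition Infinity1 : form 0 :=
  Ex (is_empty v0 ∧ v0 ∈ Omega) ∧
  AllIn Omega (Ex (is_succ v0 v1 ∧ v0 ∈ Omega)).

(* context: parameters; [p] is ψ in the context extended with x *)
Definition Infinity2 n (p : form (S n)) : form 0 :=
  close
    (Ex (is_empty v0 ∧ p) ∧
     AllIn Omega (p ⇒ Ex (is_succ v0 v1 ∧ ren p (flift Fin.FS))) ⇒
     AllIn Omega p).

Inductive CZF0 : form 0 -> Prop :=
| CZF0_ext : CZF0 Extensionality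
| CZF0_pairing : CZF0 Pairing
| CZF0_union : CZF0 Union
| CZF0_empty : CZF0 Emptyset
| CZF0_inter : CZF0 Intersection
| CZF0_repl n (p : form (S (S (S n)))) : CZF0 (Replacement p)
| CZF0_inf1 : CZF0 Infinity1
| CZF0_inf2 n (p : form (S n)) : CZF0 (Infinity2 p).

(* e ⊆ g × g *)
Definition is_graph n (g e : term n) : form n :=
  AllIn e (ExIn (up g) (ExIn (up (up g)) (is_opair v2 v1 v0))).

(* c is a function with domain g *)
Definition is_function n (c g : term n) : form n :=
  AllIn c (ExIn (up g) (Ex (is_opair v2 v1 v0))) ∧
  AllIn g (ExU (opair_in v1 v0 (up (up c)))).

(* c is a function on g and, for x ∈ g and u = c(x),
   w ∈ u iff there is y with (x, y) ∈ e and w = c(y);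
   the bound variables are x, u, w, y, in this order. *)
Definition is_colouring n (c g e : term n) : form n :=
  is_function c g ∧
  AllIn g (All (opair_in v1 v0 (up (up c)) ⇒
    All (v0 ∈ v1 ⇔
      Ex (opair_in v3 v0 (up (up (up (up e)))) ∧
          opair_in v0 v1 (up (up (up (up c)))))))).

(* context: the set of nodes g, the set of edges e *)
Definition AFA : form 0 :=
  close (n := 2) (is_graph v1 v0 ⇒ ExU (is_colouring v0 v2 v1)).

Inductive CZF0_AFA : form 0 -> Prop :=
| CZF0_AFA_CZF0 p : CZF0 p -> CZF0_AFA p
| CZF0_AFA_AFA : CZF0_AFA AFA.

Section Interpretation.
Context {C : heyting_pretopos} {N : nno C} (S : small_maps N).
Context (V : C) (E : hom V (Ps S V)) (w : hom one V).

Fixpoint ctx (n : nat) : C :=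
  match n with
  | 0 => one
  | Datatypes.S m => prod (ctx m) V
  end.

Fixpoint proj n (i : Fin.t n) : hom (ctx n) V :=
  match i in Fin.t n return hom (ctx n) V with
  | Fin.F1 => pr2
  | Fin.FS j => proj j ∘ pr1
  end.

Definition interp_term n (t : term n) : hom (ctx n) V :=
  match t with
  | Var i => proj i
  | Omega => w ∘ bang (ctx n)
  end.

(* The subobject of V^n defined by a formula. *)
Fixpoint interp n (p : form n) : sub (ctx n) :=
  match p in form n return sub (ctx n) with
  | Bot => sub_bot _
  | s ∈ t => sub_pull (pair (E ∘ interp_term t) (interp_term s)) (mem_rel S V)
  | s ≐ t => sub_eqz (interp_term s) (interp_term t)
  | p ∧ q => sub_meet (interp p) (interp q)
  | p ∨ q => sub_join (interp p) (interp q)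
  | p ⇒ q => sub_imp (interp p) (interp q)
  | All p => sub_all (pr1 : hom (prod _ V) _) (interp p)
  | Ex p => sub_ex (pr1 : hom (prod _ V) _) (interp p)
  end.

Definition valid (p : form 0) := sub_eq (interp p) (sub_top (ctx 0)).

Definition is_model (T : form 0 -> Prop) := forall p, T p -> valid p.

End Interpretation.

(* Main.v *)
From Corelib Require Import ssreflect.
From Stdlib Require Fin.
Require Import Defs.

Set Implicit Arguments.
Unset Strict Implicit.
Unset Printing Implicit Defensive.

Local Open Scope cat_scope.

(** Validity is computed by Kripke-Joyal semantics: a formula holds at a
    generalized element [a : J -> V^n] when [a] factors through its
    interpretation, and disjunctions and existentials need only be witnessed on
    a cover of [J], that is, along a regular epimorphism. Such a semantics is
    sound for the subobject operations of a Heyting pretopos because membership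
    in a subobject descends along covers ([factors_descent]) and because
    coproducts are stable ([join_elim]).

    By Lambek's lemma [E] is an isomorphism ([final_coalgebra_iso]), so a family
    [J -> V] of sets is the same thing as a small relation between [J] and [V]:
    sets are determined by their elements ([set_ext]), and every small relation
    is the extension of a set ([compr], [mem_compr]). The existence axioms thus
    say that small relations are closed under some construction. Small maps are
    closed under composition, sums and quotients, which gives Union and Pairing
    and Replacement, and the smallness of diagonals gives the empty relation
    and intersections. For Replacement and for functions in the sense of the
    theory, the point is that a unique witness exists at the given stage and not
    just on a cover ([forces_exu]), so that a functional formula on the elements
    of a set is an arrow, whose image is small.

    Infinity: primitive recursion sends [N] to the numerals in [V], and [omega]
    is the image of [N], small because [N] is. Its elements are locally numerals,
    so induction on [omega] reduces to the fact that a subobject of [J × N]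
    closed under zero and successor is everything ([nat_induction]).

    Anti-foundation: the nodes of a graph at stage [J] form an object [X] over
    [J], and taking the small set of successors of a node makes [X] a coalgebra.
    Its arrows into the final coalgebra, the decorations, correspond to the
    colourings of the graph ([is_colouring_of], [colouring_decoration]), and
    there is exactly one: the total object of a coalgebra in a slice is itself a
    coalgebra, to which finality over the terminal object applies
    ([final_decoration]). *)

(** * Kripke-Joyal semantics of the operations on subobjects *)

Section Covers.
Context {C : pretopos}.
Implicit Types A B D I J X Y Z : C.

Lemma factors_sarr X (R : sub X) : factors (sarr R) R.
Proof. by exists (idm _); rewrite comp_idr. Qed.

Lemma cover_id X : regular_epi (idm X).
Proof.
exists X, (idm X), (idm X); split=> // Z h _.
by exists h; split; [exact: comp_idr|move=> h' <-; rewrite comp_idr].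
Qed.

(** Kripke-Joyal descent: regular epimorphisms are orthogonal to monomorphisms,
    so membership in a subobject can be checked on a cover. *)
Lemma factors_descent X J J' (q : hom J' J) (f : hom J X) (R : sub X) :
  regular_epi q -> factors (f ∘ q) R -> factors f R.
Proof.
move=> cq [h eh]; have eq := regular_epi_epi cq.
case: cq => T [a [b [eab univ]]].
have [|k [ek _]] := univ _ h.
  by apply: (@smono _ _ R); rewrite !comp_assoc eh -!comp_assoc eab.
by exists k; apply: eq; rewrite -comp_assoc ek.
Qed.

Lemma factors_im_intro X Y J (f : hom X Y) (a : hom J X) :
  factors (f ∘ a) (sub_im f).
Proof. by exists (im_epi f ∘ a); rewrite comp_assoc /= im_factor. Qed.

(** By descent the image of a composite of covers is the whole target, and the
    map onto an image is regular. *)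
Lemma cover_comp A B D (g : hom B D) (f : hom A B) :
  regular_epi g -> regular_epi f -> regular_epi (g ∘ f).
Proof.
move=> cg cf.
have [m em] : factors (idm D) (sub_im (g ∘ f)).
  apply: (factors_descent cg); apply: (factors_descent cf).
  by have := factors_im_intro (g ∘ f) (idm A); rewrite comp_idr -comp_assoc comp_idl.
rewrite /= in em.
have me : m ∘ im_mono (g ∘ f) = idm _.
  by apply: (@im_mono_mono _ _ _ (g ∘ f)); rewrite comp_assoc em comp_idl comp_idr.
have eq := im_factor (g ∘ f).
have [R [a [b [eab univ]]]] := im_epi_regular (g ∘ f).
exists R, a, b; rewrite -eq -!comp_assoc eab; split=> // X h hab.
have [k [ek ku]] := univ X h hab; exists (k ∘ m); split.
  by rewrite -comp_assoc (comp_assoc m) me comp_idl.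
move=> k' ek'; have -> : k = k' ∘ im_mono (g ∘ f).
  by apply: ku; rewrite -comp_assoc.
by rewrite -comp_assoc em comp_idr.
Qed.

Lemma factors_im_cover X Y J (f : hom X Y) (b : hom J Y) :
  factors b (sub_im f) <->
  exists (J' : C) (q : hom J' J) (a : hom J' X), regular_epi q /\ f ∘ a = b ∘ q.
Proof.
split=> [[h eh]|[J' [q [a [cq e]]]]].
- have pbq := pb_is_pullback h (im_epi f).
  exists (pb h (im_epi f)), (pb1 h (im_epi f)), (pb2 h (im_epi f)); split.
    by apply: (regular_epi_stable pbq); exact: im_epi_regular.
  rewrite -eh; move: (pb1 _ _) (pb2 _ _) pbq => p q [sq _].
  have -> : f ∘ q = im_mono f ∘ im_epi f ∘ q by rewrite im_factor.
  by rewrite -!comp_assoc /= sq.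
- apply: (factors_descent cq); exists (im_epi f ∘ a).
  by rewrite comp_assoc /= im_factor.
Qed.

Lemma factors_ex X Y J (f : hom X Y) (R : sub X) (b : hom J Y) :
  factors b (sub_ex f R) <->
  exists (J' : C) (q : hom J' J) (a : hom J' X),
    regular_epi q /\ factors a R /\ f ∘ a = b ∘ q.
Proof.
rewrite factors_im_cover; split=> [[J' [q [a [cq e]]]]|[J' [q [a [cq [[k ek] e]]]]]].
- exists J', q, (sarr R ∘ a); rewrite comp_assoc; split=> //; split=> //.
  by exists a.
- by exists J', q, k; rewrite -comp_assoc ek.
Qed.

Lemma factors_meet X J (f : hom J X) (R T : sub X) :
  factors f (sub_meet R T) <-> factors f R /\ factors f T.
Proof.
split=> [[h /= <-]|[[h <-] hT]].
- rewrite -comp_assoc; split.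
    by apply: factors_comp; exact: factors_sarr.
  by apply/factors_pull; eexists.
- by move/factors_pull: hT => [k ek]; exists k; rewrite /= -comp_assoc -ek.
Qed.

Lemma factors_eqz X Y J (a : hom J X) (f g : hom X Y) :
  factors a (sub_eqz f g) <-> f ∘ a = g ∘ a.
Proof.
split=> [[h /= <-]|e]; last exact: eqz_lift_ex e.
by rewrite !comp_assoc eqz_eq.
Qed.

Lemma from_zero_eq X Y (z : hom X zero) (f g : hom X Y) : f = g.
Proof.
have [m [mz _]] := zero_strict z.
rewrite -[f]comp_idr -[g]comp_idr -mz !comp_assoc.
by rewrite (cobang_uniq (f ∘ m)) (cobang_uniq (g ∘ m)).
Qed.

(** A stage at which falsity holds is covered by the initial object, where any
    two arrows agree. *)
Lemma bot_elim X Y J (a : hom J X) (b : hom J Y) (G : sub Y) :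
  factors a (sub_bot X) -> factors b G.
Proof.
move/factors_im_cover=> [J' [q [z [cq _]]]].
apply: (factors_descent cq); exists (cobang _ ∘ z); exact: from_zero_eq.
Qed.

Lemma join_intro_l X J (f : hom J X) (R T : sub X) :
  factors f R -> factors f (sub_join R T).
Proof.
case=> h <-; apply: factors_comp; rewrite -(copair_inl (sarr R) (sarr T)).
exact: factors_im_intro.
Qed.

Lemma join_intro_r X J (f : hom J X) (R T : sub X) :
  factors f T -> factors f (sub_join R T).
Proof.
case=> h <-; apply: factors_comp; rewrite -(copair_inr (sarr R) (sarr T)).
exact: factors_im_intro.
Qed.

(** Case analysis on a disjunction, for goals that are themselves subobjects:
    the stage is covered by a coproduct (stability of coproducts), and a
    subobject containing both summands contains the coproduct. *)
Lemma join_elim X Y J (a : hom J X) (b : hom J Y) (R T : sub X) (G : sub Y) :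
  factors a (sub_join R T) ->
  (forall J' (q : hom J' J), factors (a ∘ q) R -> factors (b ∘ q) G) ->
  (forall J' (q : hom J' J), factors (a ∘ q) T -> factors (b ∘ q) G) ->
  factors b G.
Proof.
move=> /factors_im_cover [J' [q [c [cq ec]]]] hR hT.
apply: (factors_descent cq).
have pl := pb_is_pullback c inl; have pr := pb_is_pullback c inr.
have [g [_ gi]] := coprod_stable pl pr.
have [|l el] := hR _ (q ∘ pb1 c inl).
  exists (pb2 c inl); rewrite comp_assoc -ec -comp_assoc (proj1 pl) comp_assoc.
  by rewrite copair_inl.
have [|r er] := hT _ (q ∘ pb1 c inr).
  exists (pb2 c inr); rewrite comp_assoc -ec -comp_assoc (proj1 pr) comp_assoc.
  by rewrite copair_inr.
exists (copair l r ∘ g).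
rewrite -[RHS]comp_idr -gi !comp_assoc; congr (_ ∘ _).
rewrite [LHS]copair_uniq [RHS]copair_uniq.
by rewrite -!comp_assoc !copair_inl !copair_inr el er !comp_assoc.
Qed.

Lemma join_iff X Y J (a : hom J X) (b : hom J Y) (R T : sub X) (R' T' : sub Y) :
  (forall I (q : hom I J), factors (a ∘ q) R <-> factors (b ∘ q) R') ->
  (forall I (q : hom I J), factors (a ∘ q) T <-> factors (b ∘ q) T') ->
  factors a (sub_join R T) <-> factors b (sub_join R' T').
Proof.
move=> hR hT; split=> h; apply: (join_elim h) => I q.
- by move/hR; exact: join_intro_l.
- by move/hT; exact: join_intro_r.
- by move/hR; exact: join_intro_l.
- by move/hT; exact: join_intro_r.
Qed.

End Covers.

Section Heyting.
Context {C : heyting_pretopos}.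
Implicit Types A B D I J X Y Z : C.

(** The adjunction tests inclusion of subobjects only; a generalized element
    [a] is reduced to its image, on which the fibres of [f] are covered by
    fibres over [a]. *)
Lemma factors_all X Y J (f : hom X Y) (R : sub X) (a : hom J Y) :
  factors a (sub_all f R) <->
  forall J' (q : hom J' J) (b : hom J' X), f ∘ b = a ∘ q -> factors b R.
Proof.
split=> [ha J' q b e|h].
- have /(sub_all_adj f) le : sub_le (sub_all f R) (sub_all f R).
    exact: factors_sarr.
  apply: factors_le le _; apply/factors_pull; rewrite e.
  exact: factors_comp.
- apply: (@factors_le _ _ _ _ (sub_im a)); last first.
    by rewrite -[a in factors a]comp_idr; exact: factors_im_intro.
  apply/sub_all_adj.
  have /factors_pull/factors_im_cover [J' [c [z [cc e]]]] :=
    factors_sarr (sub_pull f (sub_im a)).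
  apply: (factors_descent cc); apply: (h _ z).
  by rewrite e comp_assoc.
Qed.

Lemma factors_imp X J (R T : sub X) (a : hom J X) :
  factors a (sub_imp R T) <->
  forall J' (q : hom J' J), factors (a ∘ q) R -> factors (a ∘ q) T.
Proof.
split=> [/factors_all h J' q [b e]|h].
  by rewrite -e; apply/factors_pull; apply: h e.
apply/factors_all => J' q b e; apply/factors_pull; rewrite e.
by apply: h; exists b.
Qed.

End Heyting.

(** * Small relations *)

Section Small.
Context {C : pretopos} {N : nno C} (S : small_maps N).
Implicit Types A B D I J X Y Z : C.

(** An equalizer is a pullback of a diagonal, and diagonals are small. *)
Lemma small_equalizer A Z B (k : hom A Z) (u v : hom Z B) :
  mono k -> u ∘ k = v ∘ k ->
  (forall X (h : hom X Z), u ∘ h = v ∘ h -> exists l, k ∘ l = h) -> small S k.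
Proof.
move=> mk ek univ.
apply: (small_pullback (q := u ∘ k) (f := pair u v) _ (small_diag S B)).
split; first by rewrite !pair_comp !comp_idl -ek.
move=> X a b e.
have e1 := f_equal (comp pr1) e; have e2 := f_equal (comp pr2) e.
rewrite !pair_comp !comp_idl !pr1_pair in e1.
rewrite !pair_comp !comp_idl !pr2_pair in e2.
have [|l hl] := univ X a; first by rewrite e1 e2.
exists l; split; first by rewrite -comp_assoc hl.
by move=> k' [e3 _]; apply: mk; rewrite hl e3.
Qed.

(** The usual graph factorization: [f] is a section of the pullback of [g ∘ f]
    along [g], and such a section is an equalizer. *)
Lemma small_cancel A B D (f : hom A B) (g : hom B D) :
  small S (g ∘ f) -> small S f.
Proof.
move=> sgf; have : exists P p q, @is_pullback C P _ _ _ p q (g ∘ f) g.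
  by exists (pb (g ∘ f) g), (pb1 _ _), (pb2 _ _); exact: pb_is_pullback.
move=> [P [p [q [sq univ]]]].
have [|k [[k1 k2] _]] := univ A (idm A) f; first by rewrite comp_idr.
rewrite -k2; apply: small_comp.
  apply: (small_pullback (q := p) (f := g) _ sgf); split=> // X a b e.
  have [l [[l1 l2] lu]] := univ X b a (eq_sym e).
  by exists l; split=> // l' [e1 e2]; apply: lu.
apply: (small_equalizer (u := f ∘ p) (v := q)).
- move=> X a b e; have := f_equal (comp p) e.
  by rewrite !comp_assoc k1 !comp_idl.
- by rewrite -comp_assoc k1 comp_idr k2.
- move=> X h e; exists (p ∘ h).
  have e' : g ∘ f ∘ (p ∘ h) = g ∘ (q ∘ h) by rewrite !comp_assoc sq.
  have [l [_ lu]] := univ X _ _ e'.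
  have -> : k ∘ (p ∘ h) = l.
    by symmetry; apply lu; rewrite !comp_assoc k1 k2 comp_idl e.
  by apply lu.
Qed.

(** The initial object is the equalizer of the two disjoint coprojections
    [1 -> 1 + 1], hence small. *)
Lemma small_cobang A : small S (cobang A).
Proof.
apply: (small_equalizer (u := (inl : hom one (coprod one one)) ∘ bang A)
  (v := inr ∘ bang A)).
- by move=> X a b _; exact: from_zero_eq.
- exact: from_zero_eq (idm zero) _ _.
- move=> X h; rewrite -!comp_assoc => e.
  have [l _] := proj2 (inl_inr_disjoint one one) X _ _ e.
  exists l; exact: from_zero_eq.
Qed.

(** Images of small families are small: small maps are closed under quotients. *)
Lemma small_rel_im J X Y (p : hom X J) (y : hom X Y) :
  small S p -> small_rel (small S) (sub_im (pair p y)).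
Proof.
move=> sp; apply: (small_quotient (e := im_epi (pair p y))).
  by apply: regular_epi_epi; exact: im_epi_regular.
by rewrite -comp_assoc /= im_factor pr1_pair.
Qed.

Lemma small_rel_bot J Y : small_rel (small S) (sub_bot (prod J Y)).
Proof.
apply: (small_quotient (e := im_epi (cobang (prod J Y)))).
  by apply: regular_epi_epi; exact: im_epi_regular.
rewrite -comp_assoc /= im_factor (cobang_uniq (_ ∘ _)); exact: small_cobang.
Qed.

Lemma small_rel_join J Y (R T : sub (prod J Y)) :
  small_rel (small S) R -> small_rel (small S) T ->
  small_rel (small S) (sub_join R T).
Proof.
move=> sR sT; apply: (small_quotient (e := im_epi (copair (sarr R) (sarr T)))).
  by apply: regular_epi_epi; exact: im_epi_regular.
rewrite -comp_assoc /= im_factor.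
rewrite [_ ∘ copair _ _]copair_uniq -!comp_assoc copair_inl copair_inr.
exact: small_copair.
Qed.

Lemma small_rel_meet J Y (R T : sub (prod J Y)) :
  small_rel (small S) R -> small_rel (small S) T ->
  small_rel (small S) (sub_meet R T).
Proof.
move=> sR sT; rewrite /small_rel /= comp_assoc; apply: small_comp => //.
apply: (small_pullback (pb_is_pullback (sarr R) (sarr T))).
exact: small_cancel sT.
Qed.

Lemma graph_mono J Y (f : hom J Y) : mono (pair (idm J) f).
Proof.
move=> X a b e; have := f_equal (comp pr1) e.
by rewrite !comp_assoc pr1_pair !comp_idl.
Qed.

Definition graph J Y (f : hom J Y) : sub (prod J Y) := Sub (@graph_mono J Y f).

Lemma factors_graph J Y I (f : hom J Y) (a : hom I J) (y : hom I Y) :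
  factors (pair a y) (graph f) <-> y = f ∘ a.
Proof.
split=> [[h /= e]|->]; last by exists a; rewrite /= pair_comp comp_idl.
have := f_equal (comp pr2) e; have := f_equal (comp pr1) e.
rewrite !comp_assoc !pr1_pair !pr2_pair comp_idl => ->.
by move=> ->.
Qed.

Lemma small_rel_graph J Y (f : hom J Y) : small_rel (small S) (graph f).
Proof. rewrite /small_rel /= pr1_pair; exact: small_id. Qed.

End Small.

(** * Final coalgebras *)

Section Coalgebra.
Context {C : pretopos} {N : nno C} (S : small_maps N).
Implicit Types A B D I J X Y Z : C.

Lemma Ps_map_isinE J X Y (h : hom X Y) (k : hom J (Ps S X)) (y : hom J Y) :
  isin (Ps_map S h ∘ k) y <->
  exists (J' : C) (q : hom J' J) (x : hom J' X),
    regular_epi q /\ isin (k ∘ q) x /\ h ∘ x = y ∘ q.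
Proof.
rewrite classify_isin factors_ex.
split=> [[J' [q [a [cq [ha e]]]]]|[J' [q [x [cq [hx e]]]]]].
- exists J', q, (pr2 ∘ a).
  move: e ha; rewrite [a]pair_uniq pmap_pair comp_idl pair_comp => e.
  have := f_equal (comp pr2) e; have := f_equal (comp pr1) e.
  by rewrite !pr1_pair !pr2_pair => -> ->.
- exists J', q, (pair (k ∘ q) x).
  by rewrite pmap_pair comp_idl pair_comp e.
Qed.

Lemma Ps_map_intro J X Y (h : hom X Y) (k : hom J (Ps S X)) (x : hom J X) :
  isin k x -> isin (Ps_map S h ∘ k) (h ∘ x).
Proof.
move=> hx; apply/Ps_map_isinE; exists J, (idm J), x.
by rewrite !comp_idr; split=> //; exact: cover_id.
Qed.

Lemma isin_descent J J' X (q : hom J' J) (k : hom J (Ps S X)) (x : hom J X) :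
  regular_epi q -> isin (k ∘ q) (x ∘ q) -> isin k x.
Proof. by move=> cq; rewrite /isin -pair_comp; exact: factors_descent. Qed.

Lemma Ps_map_id X : Ps_map S (idm X) = idm (Ps S X).
Proof.
apply: Ps_ext => J q y; split; last first.
  by rewrite -[y in isin (Ps_map _ _ ∘ _) y]comp_idl comp_idl;
    exact: Ps_map_intro.
move/Ps_map_isinE => [J' [c [x [cc [hx]]]]]; rewrite comp_idl comp_idl => e.
by apply: (isin_descent cc); rewrite -e.
Qed.

Lemma Ps_map_comp X Y Z (g : hom Y Z) (f : hom X Y) :
  Ps_map S g ∘ Ps_map S f = Ps_map S (g ∘ f).
Proof.
apply: Ps_ext => J q z; rewrite -comp_assoc; split=> /Ps_map_isinE.
- move=> [J1 [c [y [cc [hy e]]]]].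
  move: hy; rewrite -comp_assoc => /Ps_map_isinE [J2 [d [x [cd [hx ex]]]]].
  apply: (isin_descent cc); apply: (isin_descent cd).
  rewrite -e -(comp_assoc g) -ex comp_assoc -!(comp_assoc (Ps_map _ _)).
  exact: Ps_map_intro.
- move=> [J' [c [x [cc [hx e]]]]]; apply: (isin_descent cc).
  by rewrite -e -!comp_assoc; do 2 apply: Ps_map_intro.
Qed.

(** Reading [E] as the identification of a set with its elements, this says
    [h x = { h y | y ∈ r x }]. *)
Definition decoration X V (E : hom V (Ps S V)) (r : hom X (Ps S X))
    (h : hom X V) := E ∘ h = Ps_map S h ∘ r.

Lemma bang_eq X (f g : hom X one) : f = g.
Proof. by rewrite (bang_uniq f) (bang_uniq g). Qed.

Lemma underlying_over X (r : hom X (Ps S X)) :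
  fiber_part S (bang X) ∘ pair (bang X) r = pr2 ∘ pair (bang X) r.
Proof.
apply: Ps_ext => J q y; rewrite -!comp_assoc fiber_part_isin.
by split=> [[]//|h]; split=> //; exact: bang_eq.
Qed.

Lemma underlying_proj X (r : hom X (Ps S X)) :
  PsI_proj S (bang X) ∘ eqz_lift (underlying_over r) = bang X.
Proof. exact: bang_eq. Qed.

Definition coalgebra_over_one X (r : hom X (Ps S X)) : coalgebra S one :=
  Coalgebra (underlying_proj r).

Lemma cst_part_isin I J X (i : hom J I) (k : hom J (Ps S X)) (x : hom J (prod I X)) :
  isin (cst_part S I X ∘ pair i k) x <-> pr1 ∘ x = i /\ isin k (pr2 ∘ x).
Proof.
rewrite classify_isin; split.
- move=> [z /=]; rewrite -comp_assoc.
  have : factors (sarr (rel_of (X:=X) pr2) ∘ z) (rel_of (s:=S) (I:=prod I (Ps S X)) pr2).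
    by exists z.
  move: (sarr (rel_of pr2) ∘ z) => y hy; rewrite !pair_comp => e.
  have e1 := f_equal (comp pr1) e; have e2 := f_equal (comp pr2) e.
  rewrite !pr1_pair in e1; rewrite !pr2_pair in e2.
  rewrite -e2 pr1_pair pr2_pair -comp_assoc e1 pr1_pair; split=> //.
  have <- : pr2 ∘ pair i k = k by rewrite pr2_pair.
  by apply: (proj1 (rel_of_isin _ _ _)); rewrite -e1 -pair_uniq.
- move=> [<- hx].
  have hx' : isin (pr2 ∘ pair (pr1 ∘ x) k) (pr2 ∘ x) by rewrite pr2_pair.
  have [z ez] := proj2 (rel_of_isin _ _ _) hx'.
  exists z; rewrite /= -comp_assoc ez !pair_comp -!comp_assoc !pr1_pair !pr2_pair.
  by rewrite -pair_uniq.
Qed.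

(** Up to the isomorphism of [1 × V] with [V], the constant coalgebra over the
    terminal object is [E] itself. *)
Lemma coalgebra_mor_one X V (E : hom V (Ps S V)) (r : hom X (Ps S X)) (h : hom X V) :
  @coalgebra_mor _ _ S one (coalgebra_over_one r) (cst_coalgebra one E)
    (pair (bang X) h) <-> decoration E r h.
Proof.
have key : cst_part S one V ∘ pair (bang X) (E ∘ h) =
    Ps_map S (pair (bang X) h) ∘ r <-> decoration E r h.
  have e1 J (q : hom J X) y :
      isin (cst_part S one V ∘ pair (bang X) (E ∘ h) ∘ q) y <->
      isin (E ∘ h ∘ q) (pr2 ∘ y).
    rewrite -comp_assoc pair_comp cst_part_isin; split=> [[]//|?].
    by split=> //; exact: bang_eq.
  have e2 J (q : hom J X) y :
      isin (Ps_map S (pair (bang X) h) ∘ r ∘ q) y <->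
      isin (Ps_map S h ∘ r ∘ q) (pr2 ∘ y).
    rewrite -!comp_assoc; split=> /Ps_map_isinE [J' [c [x [cc [hx e]]]]];
      apply/Ps_map_isinE; exists J', c, x; split=> //; split=> //.
      by rewrite -comp_assoc -e comp_assoc pr2_pair.
    apply: pair_ext; first exact: bang_eq.
    by rewrite !comp_assoc pr2_pair e.
  split=> e; apply: Ps_ext => J q y; last by rewrite e1 e2 e.
  have <- : pr2 ∘ pair (bang J) y = y by rewrite pr2_pair.
  by rewrite -e1 -e2 e.
rewrite -key.
have lhs : PsI_incl S pr1 ∘ (PsI_cst S one V ∘ pmap (idm one) E ∘ pair (bang X) h)
    = pair (bang X) (cst_part S one V ∘ pair (bang X) (E ∘ h)).
  rewrite -comp_assoc pmap_pair comp_assoc /PsI_incl eqz_arr_lift pair_comp.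
  by rewrite comp_idl pr1_pair.
have rhs (e : pr1 ∘ pair (bang X) h = bang X) :
    PsI_incl S pr1 ∘ (PsI_map S e ∘ eqz_lift (underlying_over r))
    = pair (bang X) (Ps_map S (pair (bang X) h) ∘ r).
  rewrite comp_assoc /PsI_incl eqz_arr_lift -comp_assoc eqz_arr_lift pmap_pair.
  by rewrite comp_idl.
split=> [[e h1]|e].
  move/(f_equal (comp (PsI_incl S pr1))): h1; rewrite lhs rhs.
  by move/(f_equal (comp pr2)); rewrite !pr2_pair.
exists (pr1_pair _ _); apply: eqz_mono; rewrite [LHS]lhs [RHS]rhs.
by rewrite e.
Qed.

Lemma final_decoration V (E : hom V (Ps S V)) :
  indexed_final_coalgebra E ->
  forall X (r : hom X (Ps S X)), exists! h : hom X V, decoration E r h.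
Proof.
move=> HE X r; have [h [hm hu]] := HE one (coalgebra_over_one r).
have to1 (g : hom X (prod one V)) : g = pair (bang X) (pr2 ∘ g).
  by apply: pair_ext; [exact: bang_eq|rewrite pr2_pair].
rewrite [h in coalgebra_mor h]to1 in hm.
exists (pr2 ∘ h); split; first exact: (proj1 (coalgebra_mor_one E r _)) hm.
move=> g hg; have := hu _ (proj2 (coalgebra_mor_one E r g) hg) => ->.
by rewrite pr2_pair.
Qed.

(** Lambek's lemma. *)
Lemma final_coalgebra_iso V (E : hom V (Ps S V)) :
  indexed_final_coalgebra E ->
  exists F : hom (Ps S V) V, E ∘ F = idm (Ps S V) /\ F ∘ E = idm V.
Proof.
move=> HE; have fin := final_decoration HE.
have [F [hF _]] := fin _ (Ps_map S E).
have [i [_ iu]] := fin _ E.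
have FE : F ∘ E = idm V.
  have <- : i = F ∘ E.
    by apply: iu; rewrite /decoration comp_assoc hF Ps_map_comp.
  by apply: iu; rewrite /decoration Ps_map_id comp_idl comp_idr.
by exists F; split=> //; rewrite hF Ps_map_comp FE Ps_map_id.
Qed.

End Coalgebra.

(** * Sets as generalized elements of the universe *)

Section Universe.
Context {C : heyting_pretopos} {N : nno C} (S : small_maps N).
Context (V : C) (E : hom V (Ps S V)) (F : hom (Ps S V) V).
Context (EF : E ∘ F = idm (Ps S V)) (FE : F ∘ E = idm V).
Implicit Types I J X Y Z : C.

Definition mem J (x y : hom J V) := isin (E ∘ y) x.

Lemma mem_comp J J' (q : hom J' J) (x y : hom J V) :
  mem x y -> mem (x ∘ q) (y ∘ q).
Proof. by rewrite /mem comp_assoc; exact: isin_comp. Qed.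

Lemma mem_descent J J' (q : hom J' J) (x y : hom J V) :
  regular_epi q -> mem (x ∘ q) (y ∘ q) -> mem x y.
Proof. by move=> cq; rewrite /mem comp_assoc; exact: isin_descent. Qed.

Lemma set_ext J (x y : hom J V) :
  (forall J' (q : hom J' J) z, mem z (x ∘ q) <-> mem z (y ∘ q)) -> x = y.
Proof.
move=> h; rewrite -[x]comp_idl -[y]comp_idl -FE -!comp_assoc; congr (_ ∘ _).
by apply: Ps_ext => J' q z; rewrite -!comp_assoc; exact: h.
Qed.

Definition elements J (x : hom J V) : sub (prod J V) := rel_of (E ∘ x).

Lemma small_rel_elements J (x : hom J V) : small_rel (small S) (elements x).
Proof. exact: rel_of_small. Qed.

Lemma factors_elements I J (x : hom J V) (q : hom I J) (z : hom I V) :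
  factors (pair q z) (elements x) <-> mem z (x ∘ q).
Proof. by rewrite rel_of_isin /mem comp_assoc. Qed.

(** Comprehension, in the only form available: the extension must be small over
    the parameters. *)
Definition compr J (R : sub (prod J V)) (sR : small_rel (small S) R) : hom J V :=
  F ∘ classify sR.

Lemma mem_compr I J (R : sub (prod J V)) (sR : small_rel (small S) R)
    (q : hom I J) (z : hom I V) :
  mem z (compr sR ∘ q) <-> factors (pair q z) R.
Proof. by rewrite /mem /compr !comp_assoc EF comp_idl classify_isin. Qed.

Lemma eq_compr J (R : sub (prod J V)) (sR : small_rel (small S) R) (t : hom J V) :
  t = compr sR <->
  forall I (q : hom I J) z, mem z (t ∘ q) <-> factors (pair q z) R.
Proof.
split=> [-> I q z|h]; first exact: mem_compr.
by apply: set_ext => I q z; rewrite h mem_compr.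
Qed.

Definition upair J (x y : hom J V) : hom J V :=
  compr (small_rel_join (small_rel_graph S x) (small_rel_graph S y)).

Definition opair J (x y : hom J V) : hom J V := upair (upair x x) (upair x y).

Definition empty J : hom J V := compr (small_rel_bot S J V).

Definition succ J (x : hom J V) : hom J V :=
  compr (small_rel_join (small_rel_elements x) (small_rel_graph S x)).

(** Unordered pairs are only locally decided, so case analysis is available
    for goals that can be checked on a cover, such as equations. *)
Lemma upair_elim J Y (x y z : hom J V) (b : hom J Y) (G : sub Y) :
  mem z (upair x y) ->
  (forall J' (q : hom J' J), z ∘ q = x ∘ q -> factors (b ∘ q) G) ->
  (forall J' (q : hom J' J), z ∘ q = y ∘ q -> factors (b ∘ q) G) ->
  factors b G.
Proof.
rewrite -[upair x y]comp_idr => /mem_compr h hx hy.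
by apply: (join_elim h) => J' q; rewrite pair_comp comp_idl => /factors_graph;
  [exact: hx|exact: hy].
Qed.

Lemma upair_elim_eq J Y (x y z : hom J V) (f g : hom J Y) :
  mem z (upair x y) ->
  (forall J' (q : hom J' J), z ∘ q = x ∘ q -> f ∘ q = g ∘ q) ->
  (forall J' (q : hom J' J), z ∘ q = y ∘ q -> f ∘ q = g ∘ q) -> f = g.
Proof.
move=> h hx hy; rewrite -[f]comp_idr -[g]comp_idr.
by apply/factors_eqz; apply: (upair_elim h) => J' q e; rewrite comp_idl;
  apply/factors_eqz; [exact: hx|exact: hy].
Qed.

Lemma upair_l J (x y : hom J V) : mem x (upair x y).
Proof.
rewrite -[upair x y]comp_idr; apply/mem_compr; apply: join_intro_l.
by apply/factors_graph; rewrite comp_idr.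
Qed.

Lemma upair_r J (x y : hom J V) : mem y (upair x y).
Proof.
rewrite -[upair x y]comp_idr; apply/mem_compr; apply: join_intro_r.
by apply/factors_graph; rewrite comp_idr.
Qed.

Lemma mem_sing J (x z : hom J V) : mem z (upair x x) -> z = x.
Proof. by move=> h; apply: (upair_elim_eq h). Qed.

Lemma upair_comp I J (x y : hom J V) (q : hom I J) :
  upair x y ∘ q = upair (x ∘ q) (y ∘ q).
Proof.
apply/eq_compr => K r z; rewrite -comp_assoc mem_compr.
split=> h; apply: (join_elim h) => L s; rewrite !pair_comp => /factors_graph ->;
  [apply: join_intro_l|apply: join_intro_r|apply: join_intro_l|apply: join_intro_r];
  by apply/factors_graph; rewrite !comp_assoc.
Qed.

Lemma opair_comp I J (x y : hom J V) (q : hom I J) :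
  opair x y ∘ q = opair (x ∘ q) (y ∘ q).
Proof. by rewrite /opair !upair_comp. Qed.

(** Injectivity of Kuratowski pairs, with the case distinctions made locally. *)
Lemma opair_inj J (x y x' y' : hom J V) :
  opair x y = opair x' y' -> x = x' /\ y = y'.
Proof.
rewrite /opair => e.
have ex : x = x'.
  have h : mem (upair x x) (upair (upair x' x') (upair x' y')).
    by rewrite -e; exact: upair_l.
  apply: (upair_elim_eq h) => I q; rewrite !upair_comp => eq.
    by apply: mem_sing; rewrite -eq; exact: upair_l.
  by symmetry; apply: mem_sing; rewrite eq; exact: upair_l.
split=> //; rewrite -{}ex in e.
have h : mem (upair x y) (upair (upair x x) (upair x y')).
  by rewrite -e; exact: upair_r.
have h' : mem (upair x y') (upair (upair x x) (upair x y)).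
  by rewrite e; exact: upair_r.
apply: (upair_elim_eq h) => I q; rewrite !upair_comp => eq.
- have ey : y ∘ q = x ∘ q by apply: mem_sing; rewrite -eq; exact: upair_r.
  rewrite ey; symmetry; apply: mem_sing.
  have := mem_comp q h'; rewrite !upair_comp eq => /mem_sing <-.
  exact: upair_r.
- have hy : mem (y ∘ q) (upair (x ∘ q) (y' ∘ q)) by rewrite -eq; exact: upair_r.
  have hy' : mem (y' ∘ q) (upair (x ∘ q) (y ∘ q)) by rewrite eq; exact: upair_r.
  apply: (upair_elim_eq hy) => K r // e1.
  have := mem_comp r hy'; rewrite upair_comp e1 => /mem_sing ->.
  by [].
Qed.

Lemma empty_comp I J (q : hom I J) : empty J ∘ q = empty I.
Proof.
apply/eq_compr => K r z; rewrite -comp_assoc mem_compr.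
by split; exact: bot_elim.
Qed.

Lemma succ_comp I J (x : hom J V) (q : hom I J) : succ x ∘ q = succ (x ∘ q).
Proof.
apply/eq_compr => K r z; rewrite -comp_assoc mem_compr.
split=> h; apply: (join_elim h) => L s; rewrite !pair_comp.
- move/factors_elements => hz; apply: join_intro_l; apply/factors_elements.
  by rewrite -!comp_assoc in hz *.
- move/factors_graph => hz; apply: join_intro_r; apply/factors_graph.
  by rewrite hz !comp_assoc.
- move/factors_elements => hz; apply: join_intro_l; apply/factors_elements.
  by rewrite -!comp_assoc in hz *.
- move/factors_graph => hz; apply: join_intro_r; apply/factors_graph.
  by rewrite hz !comp_assoc.
Qed.

(** * Forcing of formulas *)

Section Forcing.
Context (w : hom one V).

Local Notation ctx := (ctx V).
Local Notation ev t a := (interp_term w t ∘ a).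

Definition extend J n (a : hom J (ctx n)) (x : hom J V) :
  hom J (ctx (Datatypes.S n)) := pair a x.

Lemma extend_comp I J n (a : hom J (ctx n)) x (q : hom I J) :
  extend a x ∘ q = extend (a ∘ q) (x ∘ q).
Proof. exact: pair_comp. Qed.

(** Keeping [n] visible makes the context of a formula inferable also when
    [ctx n] has been reduced to a product. *)
Definition forces J n (a : hom J (ctx n)) (p : form n) := factors a (interp E w p).
Local Notation "a ⊩ p" := (forces a p) (at level 70).

Lemma forces_comp I J n (p : form n) (a : hom J (ctx n)) (q : hom I J) :
  a ⊩ p -> a ∘ q ⊩ p.
Proof. exact: factors_comp. Qed.

Lemma forces_descent I J n (p : form n) (a : hom J (ctx n)) (q : hom I J) :
  regular_epi q -> a ∘ q ⊩ p -> a ⊩ p.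
Proof. exact: factors_descent. Qed.

Lemma ev_up J n (t : term n) (a : hom J (ctx n)) (x : hom J V) :
  ev (up t) (extend a x) = ev t a.
Proof.
case: t => [i|] /=; first by rewrite /extend -comp_assoc pr1_pair.
by rewrite -!comp_assoc; congr (_ ∘ _); exact: bang_eq.
Qed.

Lemma ev_v0 J n (a : hom J (ctx n)) (x : hom J V) :
  ev (Var (Fin.F1)) (extend a x) = x.
Proof. exact: pr2_pair. Qed.

Lemma ev_FS J n i (a : hom J (ctx n)) (x : hom J V) :
  ev (Var (Fin.FS i)) (extend a x) = ev (Var i) a.
Proof. exact: (ev_up (Var i)). Qed.

Lemma ev_comp I J n (t : term n) (a : hom J (ctx n)) (q : hom I J) :
  ev t (a ∘ q) = ev t a ∘ q.
Proof. exact: comp_assoc. Qed.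

Lemma ev_omega J n (a : hom J (ctx n)) : ev Omega a = w ∘ bang J.
Proof. by rewrite /= -comp_assoc (bang_uniq (bang _ ∘ a)). Qed.

Definition evE := (ev_up, ev_v0, ev_FS, ev_comp).

Lemma forces_mem J n (s t : term n) (a : hom J (ctx n)) :
  (a ⊩ Mem s t) <-> mem (ev s a) (ev t a).
Proof. by rewrite /forces factors_pull pair_comp -comp_assoc. Qed.

Lemma forces_eq J n (s t : term n) (a : hom J (ctx n)) :
  (a ⊩ Eqn s t) <-> ev s a = ev t a.
Proof. exact: factors_eqz. Qed.

Lemma forces_and J n (p r : form n) (a : hom J (ctx n)) :
  (a ⊩ And p r) <-> (a ⊩ p) /\ (a ⊩ r).
Proof. exact: factors_meet. Qed.

Lemma forces_imp J n (p r : form n) (a : hom J (ctx n)) :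
  (a ⊩ Imp p r) <-> forall I (q : hom I J), a ∘ q ⊩ p -> a ∘ q ⊩ r.
Proof. exact: factors_imp. Qed.

Lemma forces_iff J n (p r : form n) (a : hom J (ctx n)) :
  (a ⊩ Iff p r) <-> forall I (q : hom I J), a ∘ q ⊩ p <-> a ∘ q ⊩ r.
Proof.
rewrite forces_and !forces_imp; split=> [[h1 h2] I q|h].
  by split; [exact: h1|exact: h2].
by split=> I q /h.
Qed.

Lemma forces_all J n (p : form (Datatypes.S n)) (a : hom J (ctx n)) :
  (a ⊩ All p) <-> forall I (q : hom I J) x, extend (a ∘ q) x ⊩ p.
Proof.
rewrite /forces factors_all; split=> [h I q x|h I q b e].
  by apply: (h _ q); rewrite /extend pr1_pair.
by rewrite [b]pair_uniq e; exact: h.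
Qed.

Lemma forces_ex J n (p : form (Datatypes.S n)) (a : hom J (ctx n)) :
  (a ⊩ Ex p) <-> exists I (c : hom I J) x, regular_epi c /\ extend (a ∘ c) x ⊩ p.
Proof.
rewrite /forces factors_ex; split=> [[I [c [b [cc [hb e]]]]]|[I [c [x [cc h]]]]].
  by exists I, c, (pr2 ∘ b); split=> //; rewrite /extend -e -pair_uniq.
by exists I, c, (extend (a ∘ c) x); rewrite /extend pr1_pair.
Qed.

Lemma forces_ex_intro J n (p : form (Datatypes.S n)) (a : hom J (ctx n)) x :
  extend a x ⊩ p -> a ⊩ Ex p.
Proof.
move=> h; apply/forces_ex; exists J, (idm J), x; rewrite comp_idr.
by split=> //; exact: cover_id.
Qed.

Lemma forces_allin J n t (p : form (Datatypes.S n)) (a : hom J (ctx n)) :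
  (a ⊩ AllIn t p) <->
  forall I (q : hom I J) x, mem x (ev t a ∘ q) -> extend (a ∘ q) x ⊩ p.
Proof.
rewrite forces_all; split=> h I q x.
  have /forces_imp := h I q x.
  move=> /(_ I (idm I)); rewrite comp_idr forces_mem !evE.
  by [].
apply/forces_imp => K r; rewrite extend_comp forces_mem !evE -!comp_assoc ev_comp.
exact: h.
Qed.

Lemma forces_exin J n t (p : form (Datatypes.S n)) (a : hom J (ctx n)) :
  (a ⊩ ExIn t p) <->
  exists I (c : hom I J) x,
    regular_epi c /\ mem x (ev t a ∘ c) /\ extend (a ∘ c) x ⊩ p.
Proof.
rewrite forces_ex; split=> [[I [c [x [cc h]]]]|[I [c [x [cc h]]]]];
  exists I, c, x; split=> //.
  by move: h; rewrite forces_and forces_mem !evE.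
by apply/forces_and; rewrite forces_mem !evE.
Qed.

(** The renaming acts on contexts through the projections, so that neither
    environment has to be computed from the other. *)
Lemma forces_ren n (p : form n) m (r : Fin.t n -> Fin.t m) J
    (a : hom J (ctx n)) (b : hom J (ctx m)) :
  (forall i, proj V i ∘ a = proj V (r i) ∘ b) ->
  (b ⊩ ren p r) <-> (a ⊩ p).
Proof.
have ev_ren k l (s : Fin.t k -> Fin.t l) I (c : hom I (ctx k)) (d : hom I (ctx l)) t :
    (forall i, proj V i ∘ c = proj V (s i) ∘ d) -> ev (tren s t) d = ev t c.
  case: t => [i|] //= _; rewrite -!comp_assoc; congr (_ ∘ _); exact: bang_eq.
have lift k l (s : Fin.t k -> Fin.t l) I (c : hom I (ctx k)) (d : hom I (ctx l))
    K (q : hom K I) x :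
    (forall i, proj V i ∘ c = proj V (s i) ∘ d) ->
    forall i, proj V i ∘ extend (c ∘ q) x = proj V (flift s i) ∘ extend (d ∘ q) x.
  move=> e i; rewrite /extend; pattern i; apply (Fin.caseS' i) => [|j] /=.
    by rewrite !pr2_pair.
  by rewrite -!comp_assoc !pr1_pair !comp_assoc e.
have tr k l (s : Fin.t k -> Fin.t l) I (c : hom I (ctx k)) (d : hom I (ctx l))
    K (q : hom K I) :
    (forall i, proj V i ∘ c = proj V (s i) ∘ d) ->
    forall i, proj V i ∘ (c ∘ q) = proj V (s i) ∘ (d ∘ q).
  by move=> e i; rewrite !comp_assoc e.
elim: p m r J a b => {n} [n|n s t|n s t|n p IHp p' IHp'|n p IHp p' IHp'|
  n p IHp p' IHp'|n p IHp|n p IHp] m r J a b e; rewrite [ren _ _]/=.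
- by split; exact: bot_elim.
- by rewrite !forces_mem !(ev_ren _ _ _ _ _ _ _ e).
- by rewrite !forces_eq !(ev_ren _ _ _ _ _ _ _ e).
- by rewrite !forces_and (IHp _ _ _ _ _ e) (IHp' _ _ _ _ _ e).
- by apply join_iff => I q; [apply IHp|apply IHp']; exact: tr.
- rewrite !forces_imp; split=> h I q.
    move=> /(IHp _ _ _ _ _ (tr _ _ _ _ _ _ _ q e))/h.
    by apply IHp'; exact: tr.
  move=> /(IHp _ _ _ _ _ (tr _ _ _ _ _ _ _ q e))/h.
  by apply IHp'; exact: tr.
- rewrite !forces_all; split=> h I q x.
    by move: (h I q x); apply IHp; exact: lift.
  by move: (h I q x); apply IHp; exact: lift.
- rewrite !forces_ex; split=> [[I [c [x [cc h]]]]|[I [c [x [cc h]]]]];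
    exists I, c, x; split=> //.
    by move: h; apply IHp; exact: lift.
  by move: h; apply IHp; exact: lift.
Qed.

(** Unique existence is witnessed at the given stage, not only on a cover: by
    uniqueness the local witness coequalizes the pair of which the cover is
    the coequalizer, and so descends. *)
Lemma forces_exu J n (p : form (Datatypes.S n)) (a : hom J (ctx n)) :
  (a ⊩ ExU p) <->
  exists y, extend a y ⊩ p /\
    forall I (q : hom I J) y', extend (a ∘ q) y' ⊩ p -> y' = y ∘ q.
Proof.
have un (I : C) (b : hom I (ctx n)) x :
    (extend b x ⊩ All (ren p (flift Fin.FS) ⇒ v0 ≐ v1)) <->
    forall K (q : hom K I) y', extend (b ∘ q) y' ⊩ p -> y' = x ∘ q.
  have rn K (d : hom K (ctx n)) u v :
      (extend (extend d u) v ⊩ ren p (flift Fin.FS)) <-> (extend d v ⊩ p).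
    apply forces_ren => i; rewrite /extend; pattern i.
    apply (Fin.caseS' i) => [|j] /=; first by rewrite !pr2_pair.
    by rewrite -!comp_assoc !pr1_pair.
  rewrite forces_all; split=> h K q y'.
    have := h K q y'; rewrite forces_imp => /(_ K (idm K)).
    by rewrite comp_idr extend_comp rn forces_eq !evE.
  apply/forces_imp => L r; rewrite !extend_comp rn forces_eq !evE.
  by rewrite -!comp_assoc; exact: h.
split.
- move/forces_ex => [I [c [x [cc /forces_and [hx /un hu]]]]].
  have ec := regular_epi_epi cc; move: (cc) => [T [u [v [euv univ]]]].
  have [|y [ey _]] := univ _ x.
    have hv : extend (a ∘ c ∘ u) (x ∘ v) ⊩ p.
      rewrite -(comp_assoc a) euv comp_assoc -extend_comp.
      exact: forces_comp.
    by rewrite -(hu _ u _ hv).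
  exists y; split.
    by apply: (forces_descent cc); rewrite extend_comp ey.
  move=> K q y' hy'; have pbq := pb_is_pullback q c.
  have cq : regular_epi (pb1 q c) by exact: regular_epi_stable pbq cc.
  apply: (regular_epi_epi cq).
  rewrite -comp_assoc (proj1 pbq) comp_assoc ey; apply: hu.
  by rewrite -comp_assoc -(proj1 pbq) comp_assoc -extend_comp; exact: forces_comp.
- move=> [y [hy hu]]; apply: (forces_ex_intro (x := y)).
  by apply/forces_and; split=> //; apply/un.
Qed.

Lemma valid_close n (p : form n) :
  valid E w (close p) <-> forall J (a : hom J (ctx n)), a ⊩ p.
Proof.
elim: n p => [|n IHn] p /=.
- split=> [[_ [h eh]] J a|h].
    by exists (h ∘ a); rewrite comp_assoc eh comp_idl.
  by split; [exists (sarr (interp E w p)); rewrite comp_idl|exact: h].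
- rewrite IHn; split=> h J a; last by apply/forces_all => I q x; exact: h.
  rewrite [a]pair_uniq -[pr1 ∘ a]comp_idr.
  by move: (h J (pr1 ∘ a)) => /forces_all; apply.
Qed.

(** * Formulas defining operations on sets *)

(** A defining condition need only be compared with the relation that it is
    meant to comprehend; extensionality does the rest. *)
Lemma forces_compr J n (a : hom J (ctx n)) t (p : form (Datatypes.S n))
    (R : sub (prod J V)) (sR : small_rel (small S) R) :
  (forall I (q : hom I J) z, extend (a ∘ q) z ⊩ p <-> factors (pair q z) R) ->
  (a ⊩ All (v0 ∈ up t ⇔ p)) <-> ev t a = compr sR.
Proof.
move=> hp; rewrite eq_compr forces_all; split=> h I q z.
- have := h I q z; rewrite forces_iff => /(_ I (idm I)).
  by rewrite comp_idr forces_mem !evE hp.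
- apply/forces_iff => K r; rewrite extend_comp forces_mem !evE -(comp_assoc a) hp.
  by rewrite -!comp_assoc comp_assoc h.
Qed.

Lemma forces_set_exists J n (a : hom J (ctx n)) p
    (R : sub (prod J V)) (sR : small_rel (small S) R) :
  (forall I (q : hom I J) z,
    extend (extend a (compr sR) ∘ q) z ⊩ p <-> factors (pair q z) R) ->
  a ⊩ Ex (All (v0 ∈ v1 ⇔ p)).
Proof.
move=> hp; apply: (forces_ex_intro (x := compr sR)).
by apply/(forces_compr v0 sR hp); rewrite !evE.
Qed.

Lemma forces_or_join J n (p r : form n) (a : hom J (ctx n)) X (b : hom J X)
    (R T : sub X) :
  (forall I (q : hom I J), a ∘ q ⊩ p <-> factors (b ∘ q) R) ->
  (forall I (q : hom I J), a ∘ q ⊩ r <-> factors (b ∘ q) T) ->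
  (a ⊩ Or p r) <-> factors b (sub_join R T).
Proof. by move=> hp hr; apply: join_iff. Qed.

Lemma forces_upair J n (t x y : term n) (a : hom J (ctx n)) :
  (a ⊩ is_upair t x y) <-> ev t a = upair (ev x a) (ev y a).
Proof.
apply: forces_compr => I q z; apply: forces_or_join => K r;
  by rewrite forces_eq pair_comp factors_graph !evE -!comp_assoc.
Qed.

Lemma forces_opair J n (t x y : term n) (a : hom J (ctx n)) :
  (a ⊩ is_opair t x y) <-> ev t a = opair (ev x a) (ev y a).
Proof.
apply: forces_compr => I q z; apply: forces_or_join => K r;
  by rewrite forces_upair pair_comp factors_graph !evE !upair_comp -!comp_assoc.
Qed.

Lemma forces_opair_in J n (t x y : term n) (a : hom J (ctx n)) :
  (a ⊩ opair_in x y t) <-> mem (opair (ev x a) (ev y a)) (ev t a).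
Proof.
split=> [/forces_ex [I [c [z [cc]]]]|h].
- rewrite forces_and forces_opair forces_mem !evE => [[-> h]].
  by apply: (mem_descent cc); rewrite opair_comp.
- apply: (forces_ex_intro (x := opair (ev x a) (ev y a))).
  by rewrite forces_and forces_opair forces_mem !evE.
Qed.

Lemma forces_empty J n (t : term n) (a : hom J (ctx n)) :
  (a ⊩ is_empty t) <-> ev t a = empty J.
Proof. by apply: forces_compr => I q z; split; exact: bot_elim. Qed.

Lemma forces_succ J n (t x : term n) (a : hom J (ctx n)) :
  (a ⊩ is_succ t x) <-> ev t a = succ (ev x a).
Proof.
apply: forces_compr => I q z; apply: forces_or_join => K r; rewrite pair_comp.
- by rewrite forces_mem factors_elements !evE -!comp_assoc.
- by rewrite forces_eq factors_graph !evE -!comp_assoc.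
Qed.

(** * The elementary set existence axioms *)

Lemma valid_extensionality : valid E w Extensionality.
Proof.
apply/valid_close => J a; apply/forces_imp => I q; rewrite forces_all => h.
rewrite forces_eq; apply: set_ext => K r z.
have := h K r z; rewrite forces_iff => /(_ K (idm K)).
by rewrite comp_idr !forces_mem !evE.
Qed.

Lemma valid_pairing : valid E w Pairing.
Proof.
apply/valid_close => J a.
apply: (forces_set_exists (sR := small_rel_join (small_rel_graph S (ev v1 a))
  (small_rel_graph S (ev v0 a)))) => I q z.
by apply: forces_or_join => K r;
  rewrite forces_eq pair_comp factors_graph !evE -!comp_assoc.
Qed.

Lemma valid_emptyset : valid E w Emptyset.
Proof.
apply/(valid_close (n := 0)) => J a.
apply: (forces_set_exists (sR := small_rel_bot S J V)) => I q z.
by split; exact: bot_elim.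
Qed.

Lemma valid_intersection : valid E w Intersection.
Proof.
apply/valid_close => J a.
apply: (forces_set_exists (sR := small_rel_meet (small_rel_elements (ev v1 a))
  (small_rel_elements (ev v0 a)))) => I q z.
by rewrite factors_meet !factors_elements forces_and !forces_mem !evE.
Qed.

(** Index and value of the generic element of [x], which lives at the stage
    [sdom (elements x)]; any element of [x] at a later stage is an instance of
    it ([el_lift]). *)
Definition el_index J (x : hom J V) : hom (sdom (elements x)) J :=
  pr1 ∘ sarr (elements x).
Definition el_value J (x : hom J V) : hom (sdom (elements x)) V :=
  pr2 ∘ sarr (elements x).

Lemma small_el_index J (x : hom J V) : small S (el_index x).
Proof. exact: rel_of_small. Qed.

Lemma el_mem J (x : hom J V) : mem (el_value x) (x ∘ el_index x).
Proof. by apply/factors_elements; rewrite -pair_uniq; exact: factors_sarr. Qed.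

Lemma el_lift I J (x : hom J V) (q : hom I J) z :
  mem z (x ∘ q) -> exists k, el_index x ∘ k = q /\ el_value x ∘ k = z.
Proof.
move=> /factors_elements [k e]; exists k.
by rewrite -!comp_assoc e pr1_pair pr2_pair.
Qed.

Lemma el_ext I J (x : hom J V) (k l : hom I (sdom (elements x))) :
  el_index x ∘ k = el_index x ∘ l -> el_value x ∘ k = el_value x ∘ l -> k = l.
Proof.
by rewrite -!comp_assoc => e1 e2; apply: (@smono _ _ (elements x)); exact: pair_ext.
Qed.

Lemma factors_im_pair X J I (p : hom X J) (y : hom X V) (q : hom I J) z :
  factors (pair q z) (sub_im (pair p y)) <->
  exists K (c : hom K I) (k : hom K X),
    regular_epi c /\ p ∘ k = q ∘ c /\ y ∘ k = z ∘ c.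
Proof.
rewrite factors_im_cover; split=> [[K [c [k [cc e]]]]|[K [c [k [cc [e1 e2]]]]]];
  exists K, c, k; split=> //; last by rewrite !pair_comp e1 e2.
have := f_equal (comp pr2) e; have := f_equal (comp pr1) e.
by rewrite !pair_comp !pr1_pair !pr2_pair.
Qed.

(** The elements of elements of [x] are indexed by a composite of two small
    maps. *)
Lemma valid_union : valid E w Union.
Proof.
apply/valid_close => J a; set x := ev v0 a; set y := el_value x.
apply: (forces_set_exists (sR := small_rel_im (el_value y)
  (small_comp (small_el_index x) (small_el_index y)))) => I q z.
rewrite factors_im_pair forces_ex; split.
- move=> [K [c [u [cc]]]].
  rewrite forces_and !forces_mem !evE -/x => [[hz hu]].
  rewrite -comp_assoc in hu; have [k [ek1 ek2]] := el_lift hu.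
  rewrite -ek2 in hz; have [l [el1 el2]] := el_lift hz.
  by exists K, c, l; rewrite -(comp_assoc (el_index x)) el1.
- move=> [K [c [l [cc [e1 e2]]]]]; exists K, c, (y ∘ el_index y ∘ l).
  split=> //; rewrite forces_and !forces_mem !evE -/x -e2.
  rewrite -(comp_assoc x) -e1; split.
    exact: mem_comp (el_mem y).
  by have := mem_comp (el_index y ∘ l) (el_mem x); rewrite -!comp_assoc.
Qed.

(** The functional formula, applied to the generic element of [a], yields an
    arrow from the small family of elements of [a]. *)
Lemma valid_replacement n (p : form (Datatypes.S (Datatypes.S (Datatypes.S n)))) :
  valid E w (Replacement p).
Proof.
apply/valid_close => J0 a0; apply/forces_imp => J q0; move: (a0 ∘ q0) => {a0 q0 J0} a.
rewrite forces_allin; set A := ev v0 a => h.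
have /forces_exu [y [hy hu]] := h _ (el_index A) _ (el_mem A).
apply: (forces_set_exists (sR := small_rel_im y (small_el_index A))) => I q z.
have rn K (b : hom K (ctx (Datatypes.S n))) t v x :
    (extend (extend (extend b t) v) x ⊩
       ren p (fcons (Fin.FS Fin.F1) (fcons Fin.F1
               (fun i => Fin.FS (Fin.FS (Fin.FS i)))))) <->
    (extend (extend b x) v ⊩ p).
  apply forces_ren => i; rewrite /extend; pattern i.
  apply (Fin.caseS' i) => [|j] /=.
    by rewrite -comp_assoc pr1_pair !pr2_pair.
  pattern j; apply (Fin.caseS' j) => [|k] /=.
    by rewrite -comp_assoc pr1_pair !pr2_pair.
  by rewrite -!comp_assoc !pr1_pair.
rewrite factors_im_pair forces_exin; split.
- move=> [K [c [x [cc]]]]; rewrite !extend_comp rn !evE -/A -comp_assoc => [[hx hp]].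
  have [k [ek1 ek2]] := el_lift hx; exists K, c, k; split=> //; split=> //.
  by symmetry; apply: hu; rewrite extend_comp ek2 -comp_assoc ek1 comp_assoc.
- move=> [K [c [k [cc [e1 e2]]]]]; exists K, c, (el_value A ∘ k); split=> //.
  rewrite !extend_comp rn !evE -/A -(comp_assoc A) -(comp_assoc a) -e1 -e2; split.
    by have := mem_comp k (el_mem A); rewrite -comp_assoc.
  by rewrite (comp_assoc a) -!extend_comp; exact: forces_comp.
Qed.

(** * Anti-foundation *)

(* Rewriting with associativity would otherwise look for composites inside
   these definitions. *)
Local Opaque el_index el_value compr.

(** The next three definitions are the Kripke-Joyal readings of the formulas
    [is_graph], [is_function] and [is_colouring] at stage [J]. The unique value
    of a function is a witness at the stage itself, other witnesses are local. *)
Definition is_graph_at J (g e : hom J V) :=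
  forall I (q : hom I J) z, mem z (e ∘ q) ->
  exists K (d : hom K I) x y, regular_epi d /\
    mem x (g ∘ q ∘ d) /\ mem y (g ∘ q ∘ d) /\ z ∘ d = opair x y.

Definition is_function_at J (c g : hom J V) :=
  (forall I (q : hom I J) z, mem z (c ∘ q) ->
     exists K (d : hom K I) x y, regular_epi d /\
       mem x (g ∘ q ∘ d) /\ z ∘ d = opair x y) /\
  (forall I (q : hom I J) x, mem x (g ∘ q) ->
     exists y, mem (opair x y) (c ∘ q) /\
       forall K (r : hom K I) y', mem (opair (x ∘ r) y') (c ∘ q ∘ r) -> y' = y ∘ r).

Definition is_colouring_at J (c g e : hom J V) :=
  is_function_at c g /\
  forall I (q : hom I J) x u, mem x (g ∘ q) -> mem (opair x u) (c ∘ q) ->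
  forall K (r : hom K I) v, mem v (u ∘ r) <->
    exists L (d : hom L K) y, regular_epi d /\
      mem (opair (x ∘ r ∘ d) y) (e ∘ q ∘ r ∘ d) /\
      mem (opair y (v ∘ d)) (c ∘ q ∘ r ∘ d).

Lemma is_graph_at_comp I J (g e : hom J V) (q : hom I J) :
  is_graph_at g e -> is_graph_at (g ∘ q) (e ∘ q).
Proof.
move=> h K r z; rewrite -comp_assoc => /h [L [d [x [y [cd H]]]]].
by exists L, d, x, y; split=> //; rewrite -(comp_assoc g).
Qed.

Lemma is_colouring_at_comp I J (c g e : hom J V) (q : hom I J) :
  is_colouring_at c g e -> is_colouring_at (c ∘ q) (g ∘ q) (e ∘ q).
Proof.
move=> [[f1 f2] f3]; split; first split; move=> K r.
- move=> z; rewrite -comp_assoc => /f1 [L [d [x [y [cd H]]]]].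
  by exists L, d, x, y; split=> //; rewrite -(comp_assoc g).
- by move=> x; rewrite -(comp_assoc g) -(comp_assoc c); exact: f2.
- by move=> x u; rewrite -!(comp_assoc _ q r); exact: f3.
Qed.

Lemma forces_is_graph J n (g e : term n) (a : hom J (ctx n)) :
  a ⊩ is_graph g e -> is_graph_at (ev g a) (ev e a).
Proof.
move/forces_allin => h I q z /h /forces_exin [I1 [c1 [x [cc1 [hx]]]]].
move=> /forces_exin [I2 [c2 [y [cc2 [hy]]]]].
rewrite forces_opair !evE => e0.
exists I2, (c1 ∘ c2), (x ∘ c2), y; split; first exact: cover_comp.
rewrite !evE in hx hy; rewrite !comp_assoc; split; first exact: mem_comp.
by split.
Qed.

Lemma forces_is_function J n (c g : term n) (a : hom J (ctx n)) :
  (a ⊩ is_function c g) <-> is_function_at (ev c a) (ev g a).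
Proof.
rewrite forces_and !forces_allin; split=> [[h1 h2]|[h1 h2]]; split=> I q z hz.
- have /forces_exin [I1 [c1 [x [cc1 [hx]]]]] := h1 _ _ _ hz.
  move=> /forces_ex [I2 [c2 [y [cc2]]]]; rewrite forces_opair !evE => e0.
  exists I2, (c1 ∘ c2), (x ∘ c2), y; split; first exact: cover_comp.
  rewrite !evE in hx; rewrite !comp_assoc; split=> //; exact: mem_comp.
- have /forces_exu [y [hy hu]] := h2 _ _ _ hz.
  exists y; move: hy; rewrite forces_opair_in !evE; split=> // K r y' hy'.
  by apply: hu; rewrite forces_opair_in !evE.
- have [K [d [x [y [cd [hx e0]]]]]] := h1 _ _ _ hz.
  apply/forces_exin; exists K, d, x; rewrite !evE; split=> //; split=> //.
  by apply: (forces_ex_intro (x := y)); rewrite forces_opair !evE.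
- have [y [hy hu]] := h2 _ _ _ hz.
  apply/forces_exu; exists y; rewrite forces_opair_in !evE; split=> // K r y'.
  by rewrite forces_opair_in !evE; exact: hu.
Qed.

Lemma forces_is_colouring J n (c g e : term n) (a : hom J (ctx n)) :
  (a ⊩ is_colouring c g e) <-> is_colouring_at (ev c a) (ev g a) (ev e a).
Proof.
have inner K (b : hom K (ctx n)) x u v :
    (extend (extend (extend b x) u) v ⊩
      Ex (opair_in v3 v0 (up (up (up (up e)))) ∧
          opair_in v0 v1 (up (up (up (up c)))))) <->
    exists L (d : hom L K) y, regular_epi d /\
      mem (opair (x ∘ d) y) (ev e b ∘ d) /\ mem (opair y (v ∘ d)) (ev c b ∘ d).
  rewrite forces_ex; split=> [[L [d [y [cd h]]]]|[L [d [y [cd h]]]]];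
    exists L, d, y; split=> //; move: h;
    by rewrite forces_and !forces_opair_in !evE.
rewrite forces_and forces_is_function forces_allin.
split=> [[hf h]|[hf h]]; split=> // I q x.
- move=> u hx hu K r v.
  have := h _ _ _ hx; rewrite forces_all => /(_ I (idm I) u).
  rewrite forces_imp => /(_ I (idm I)); rewrite !comp_idr forces_opair_in !evE.
  move=> /(_ hu); rewrite forces_all => /(_ K r v).
  rewrite forces_iff => /(_ K (idm K)).
  by rewrite comp_idr forces_mem !extend_comp inner !evE.
- move=> hx; apply/forces_all => K r u; apply/forces_imp => L s.
  rewrite forces_opair_in !evE => hu.
  apply/forces_all => M t v; apply/forces_iff => O o.
  rewrite forces_mem !extend_comp inner !evE.
  have := h L (q ∘ r ∘ s) (x ∘ r ∘ s) (u ∘ s) _ _ O (t ∘ o) (v ∘ o).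
  rewrite !comp_assoc; apply=> //.
  by do 2 apply: mem_comp.
Qed.

Section Colouring.
Context (J : C) (g e : hom J V) (Hge : is_graph_at g e).

Local Notation X := (sdom (elements g)).
Local Notation p := (el_index g).
Local Notation v := (el_value g).

(** The equalizer keeps both ends of an edge in the same fibre over [J], since
    the graph may vary with [J]. *)
Definition edge_rel : sub (prod X X) :=
  sub_meet (sub_eqz (p ∘ pr1) (p ∘ pr2))
    (sub_pull (pair (E ∘ (e ∘ (p ∘ pr1))) (opair (v ∘ pr1) (v ∘ pr2)))
      (mem_rel S V)).

Lemma factors_edge_rel I (a b : hom I X) :
  factors (pair a b) edge_rel <->
  p ∘ a = p ∘ b /\ mem (opair (v ∘ a) (v ∘ b)) (e ∘ (p ∘ a)).
Proof.
rewrite factors_meet factors_eqz factors_pull pair_comp opair_comp.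
by rewrite /mem /isin -!(comp_assoc E) -!(comp_assoc e)
  -!(comp_assoc p) -!(comp_assoc v) !pr1_pair !pr2_pair.
Qed.

(** [X ×_J X] is small over [X] because [X] is small over [J]; the edges are
    carved out of it by membership, a small monomorphism. *)
Lemma small_rel_edge : small_rel (small S) edge_rel.
Proof.
rewrite /small_rel /= (comp_assoc pr1 (eqz_arr _ _)); apply: small_comp.
  exact: small_pullback (pb_is_pullback p p) (small_el_index g).
apply: small_pullback (pb_is_pullback _ _) _.
apply: small_pullback (pb_is_pullback _ _) _.
apply: (small_cancel (g := pr1)); exact: rel_of_small.
Qed.

Definition successors : hom X (Ps S X) := classify small_rel_edge.

(** With membership unfolded, the decoration equation is the colouring equation
    for the values of [h]. *)
Lemma decorationE (h : hom X V) :
  decoration E successors h <->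
  forall I (a : hom I X) z, mem z (h ∘ a) <->
    exists K (d : hom K I) (b : hom K X), regular_epi d /\
      p ∘ (a ∘ d) = p ∘ b /\
      mem (opair (v ∘ (a ∘ d)) (v ∘ b)) (e ∘ (p ∘ (a ∘ d))) /\ h ∘ b = z ∘ d.
Proof.
have eq I (a : hom I X) z : isin (Ps_map S h ∘ successors ∘ a) z <->
    exists K (d : hom K I) (b : hom K X), regular_epi d /\
      p ∘ (a ∘ d) = p ∘ b /\
      mem (opair (v ∘ (a ∘ d)) (v ∘ b)) (e ∘ (p ∘ (a ∘ d))) /\ h ∘ b = z ∘ d.
  rewrite -comp_assoc Ps_map_isinE.
  split=> [[K [d [b [cd [hb e1]]]]]|[K [d [b [cd [e0 [hb e1]]]]]]];
    exists K, d, b; split=> //.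
    by move: hb; rewrite -comp_assoc classify_isin factors_edge_rel => [[]].
  by rewrite -comp_assoc classify_isin factors_edge_rel.
split=> [hd I a z|hd].
  by rewrite -eq -hd /mem comp_assoc.
by apply: Ps_ext => I a z; rewrite eq -hd /mem comp_assoc.
Qed.

Definition colouring_of (h : hom X V) : hom J V :=
  compr (small_rel_im (opair v h) (small_el_index g)).

Lemma mem_colouring_of (h : hom X V) I (q : hom I J) z :
  mem z (colouring_of h ∘ q) <->
  exists K (d : hom K I) (a : hom K X), regular_epi d /\ p ∘ a = q ∘ d /\
    opair (v ∘ a) (h ∘ a) = z ∘ d.
Proof.
rewrite mem_compr factors_im_pair.
by split=> [[K [d [a]]]|[K [d [a]]]] H; exists K, d, a; rewrite ?opair_comp // -opair_comp.
Qed.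

(** Nodes are determined by index and value, so the set of pairs has no value
    at a node other than that of [h]. *)
Lemma colouring_of_value (h : hom X V) I (a : hom I X) u :
  mem (opair (v ∘ a) u) (colouring_of h ∘ (p ∘ a)) <-> u = h ∘ a.
Proof.
rewrite mem_colouring_of; split=> [[K [d [b [cd [e1 e2]]]]]|->].
  apply: (regular_epi_epi cd); rewrite opair_comp in e2.
  have [e3 e4] := opair_inj e2.
  rewrite -e4 -comp_assoc; congr (_ ∘ _).
  by apply: (el_ext (x := g)); rewrite ?e1 ?e3 comp_assoc.
by exists I, (idm I), a; rewrite !comp_idr; split=> //; exact: cover_id.
Qed.

(** Being a graph is witnessed locally, and pairing is injective, so the second
    component of an edge is an instance of the generic node after a cover. *)
Lemma edge_target I (a : hom I X) y :
  mem (opair (v ∘ a) y) (e ∘ (p ∘ a)) ->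
  exists K (d : hom K I) (b : hom K X), regular_epi d /\
    p ∘ (a ∘ d) = p ∘ b /\ v ∘ b = y ∘ d.
Proof.
move=> /Hge [K [d [x' [y' [cd [_ [hy]]]]]]].
rewrite opair_comp => /opair_inj [_ ey]; rewrite -ey -comp_assoc in hy.
have [b [e1 e2]] := el_lift hy.
by exists K, d, b; rewrite e1 -comp_assoc.
Qed.

(** Successors in the sense of the graph [(g, e)] and values in the sense of the
    set of pairs [c] may be read off the family [X], as soon as [c] is the
    graph of [h]. *)
Lemma successor_values (c : hom J V) (h : hom X V) :
  (forall I (a : hom I X) u,
     mem (opair (v ∘ a) u) (c ∘ (p ∘ a)) <-> u = h ∘ a) ->
  forall I (a : hom I X) z,
  (exists K (d : hom K I) (b : hom K X), regular_epi d /\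
      p ∘ (a ∘ d) = p ∘ b /\
      mem (opair (v ∘ (a ∘ d)) (v ∘ b)) (e ∘ (p ∘ (a ∘ d))) /\ h ∘ b = z ∘ d) <->
  (exists K (d : hom K I) y, regular_epi d /\
      mem (opair (v ∘ (a ∘ d)) y) (e ∘ (p ∘ (a ∘ d))) /\
      mem (opair y (z ∘ d)) (c ∘ (p ∘ (a ∘ d)))).
Proof.
move=> val I a z; split.
- move=> [K [d [b [cd [e1 [hb e2]]]]]]; exists K, d, (v ∘ b).
  by split=> //; split=> //; rewrite e1; apply/val.
- move=> [K [d [y [cd [hy hc]]]]].
  have [L [d' [b [cd' [e1 e2]]]]] := edge_target hy.
  rewrite -comp_assoc in e1.
  exists L, (d ∘ d'), b; split; first exact: cover_comp.
  split=> //; split.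
    have := mem_comp d' hy; rewrite opair_comp -e2.
    by rewrite -!(comp_assoc v) -!(comp_assoc e) -!(comp_assoc p) -!(comp_assoc a).
  symmetry; apply/val; have := mem_comp d' hc; rewrite opair_comp -e2 -e1.
  by rewrite -(comp_assoc c) -(comp_assoc p) -(comp_assoc a) -(comp_assoc z).
Qed.

Lemma is_colouring_of (h : hom X V) :
  decoration E successors h -> is_colouring_at (colouring_of h) g e.
Proof.
move/decorationE => hd; split; first split.
- move=> I q z /mem_colouring_of [K [d [a [cd [e1 e2]]]]].
  exists K, d, (v ∘ a), (h ∘ a); split=> //; split=> //.
  rewrite -comp_assoc -e1 comp_assoc; apply: mem_comp; exact: el_mem.
- move=> I q x hx; have [a [e1 e2]] := el_lift hx; exists (h ∘ a).
  rewrite -e1 -e2 colouring_of_value; split=> // K r y'.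
  by rewrite -(comp_assoc v) -(comp_assoc (colouring_of h)) -(comp_assoc p)
    colouring_of_value comp_assoc.
- move=> I q x u hx; have [a [<- <-]] := el_lift hx.
  move=> /colouring_of_value -> K r z; rewrite -comp_assoc hd.
  rewrite (successor_values (colouring_of_value h)).
  by split=> [[L [d [y H]]]|[L [d [y H]]]]; exists L, d, y; move: H;
    rewrite -!(comp_assoc v) -!(comp_assoc e) -!(comp_assoc (colouring_of h))
      -!(comp_assoc p) -!(comp_assoc a).
Qed.

(** A function in the sense of the theory assigns to the generic node a unique
    value, and hence is the graph of an arrow on [X]. *)
Lemma colouring_decoration (c : hom J V) :
  is_colouring_at c g e ->
  exists h, decoration E successors h /\ c = colouring_of h.
Proof.
move=> [[hf1 hf2] hc]; have [h [hh hu]] := hf2 _ _ _ (el_mem g).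
have val I (a : hom I X) u :
    mem (opair (v ∘ a) u) (c ∘ (p ∘ a)) <-> u = h ∘ a.
  split=> [hm|->]; first by apply: hu; rewrite -comp_assoc.
  by have := mem_comp a hh; rewrite opair_comp -comp_assoc.
exists h; split.
- apply/decorationE => I a z; rewrite (successor_values val).
  have hx : mem (v ∘ a) (g ∘ (p ∘ a)).
    by rewrite comp_assoc; apply: mem_comp; exact: el_mem.
  have := hc _ _ _ _ hx (proj2 (val _ _ _) eq_refl) _ (idm I) z.
  rewrite !comp_idr => ->.
  by split=> [[L [d [y H]]]|[L [d [y H]]]]; exists L, d, y; move: H;
    rewrite -!(comp_assoc v) -!(comp_assoc e) -!(comp_assoc c)
      -!(comp_assoc p).
- apply: set_ext => I q z; rewrite mem_colouring_of; split.
  + move=> hz; have [K [d [x [y [cd [hx ez]]]]]] := hf1 _ _ _ hz.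
    rewrite -comp_assoc in hx; have [a [e1 e2]] := el_lift hx.
    exists K, d, a; split=> //; split=> //.
    have := mem_comp d hz; rewrite ez -e2 -comp_assoc -e1.
    by move=> /val ->.
  + move=> [K [d [a [cd [e1 e2]]]]]; apply: (mem_descent cd).
    by rewrite -e2 -comp_assoc -e1; apply/val.
Qed.

End Colouring.

Context (fin : forall X (r : hom X (Ps S X)), exists! h : hom X V, decoration E r h).

(** Two colourings at a later stage [I] are graphs of decorations of the graph
    restricted to [I], which has only one. *)
Lemma valid_AFA : valid E w AFA.
Proof.
apply/valid_close => J0 a0; apply/forces_imp => J q0.
move: (a0 ∘ q0) => {a0 q0 J0} a /forces_is_graph.
set g := ev v1 a; set e := ev v0 a => Hge.
have [h [hd _]] := fin (successors g e).
apply/forces_exu; exists (colouring_of h).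
rewrite forces_is_colouring !evE; split; first exact: is_colouring_of.
move=> I q c; rewrite forces_is_colouring !evE -/g -/e => hc.
have Hge' := is_graph_at_comp (q := q) Hge.
have hc' := is_colouring_at_comp q (is_colouring_of Hge hd).
have [k [kd ->]] := colouring_decoration Hge' hc.
have [l [ld ->]] := colouring_decoration Hge' hc'.
have [m [_ mu]] := fin (successors (g ∘ q) (e ∘ q)).
by rewrite -(mu k kd) -(mu l ld).
Qed.

End Forcing.

(** * Infinity *)

Section Infinity.
Context (num : hom (nat_obj N) V).
Context (num_zero : num ∘ nat_zero N = empty one).
Context (num_succ : num ∘ nat_succ N = succ num).

(** Induction over the natural numbers for subobjects with parameters in [J]:
    recursion produces a section of the inclusion of [T]. *)
Lemma nat_induction J (T : sub (prod J (nat_obj N))) :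
  factors (pair (idm J) (nat_zero N ∘ bang J)) T ->
  (forall I (q : hom I J) m, factors (pair q m) T ->
     factors (pair q (nat_succ N ∘ m)) T) ->
  forall I (q : hom I J) m, factors (pair q m) T.
Proof.
move=> [z ez] hs.
have [t et] : factors (pair (pr1 ∘ sarr T) (nat_succ N ∘ (pr2 ∘ sarr T))) T.
  by apply: hs; rewrite -pair_uniq; exact: factors_sarr.
have [h [[h1 h2] _]] := nat_rec N z (t ∘ pr2).
have [k [_ ku]] := nat_rec N (pair (idm J) (nat_zero N ∘ bang J))
  (pmap (idm J) (nat_succ N) ∘ pr2).
have e1 : k = idm _.
  apply: ku; split; first by rewrite comp_idl.
  by rewrite comp_idl -comp_assoc pr2_pair comp_idr.
have e2 : k = sarr T ∘ h.
  apply: ku; split; first by rewrite -comp_assoc h1.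
  rewrite -comp_assoc h2 -!comp_assoc !pr2_pair comp_assoc et /pmap !pair_comp.
  by rewrite comp_idl -!comp_assoc.
move=> I q m; exists (h ∘ pair q m).
by rewrite comp_assoc -e2 e1 comp_idl.
Qed.

Definition omega : hom one V := compr (small_rel_im num (small_nat S)).

Lemma mem_omega J (x : hom J V) :
  mem x (omega ∘ bang J) <->
  exists K (d : hom K J) m, regular_epi d /\ num ∘ m = x ∘ d.
Proof.
rewrite mem_compr factors_im_pair.
split=> [[K [d [m [cd [_ e]]]]]|[K [d [m [cd e]]]]]; exists K, d, m => //.
by split=> //; split=> //; exact: bang_eq.
Qed.

Local Notation ev t a := (interp_term omega t ∘ a).
Local Notation "a ⊩ p" := (forces omega a p) (at level 70).

Lemma num_zero_at J : num ∘ (nat_zero N ∘ bang J) = empty J.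
Proof. by rewrite comp_assoc num_zero empty_comp. Qed.

Lemma num_succ_at J (m : hom J (nat_obj N)) :
  num ∘ (nat_succ N ∘ m) = succ (num ∘ m).
Proof. by rewrite comp_assoc num_succ succ_comp. Qed.

Lemma mem_omega_num J m : mem (num ∘ m) (omega ∘ bang J).
Proof.
apply/mem_omega; exists J, (idm J), m; rewrite comp_idr.
by split=> //; exact: cover_id.
Qed.

Lemma mem_omega_succ J x :
  mem x (omega ∘ bang J) -> mem (succ x) (omega ∘ bang J).
Proof.
move=> /mem_omega [K [d [m [cd e]]]]; apply/mem_omega.
by exists K, d, (nat_succ N ∘ m); rewrite num_succ_at e succ_comp.
Qed.

Lemma valid_infinity1 : valid E omega Infinity1.
Proof.
apply/(valid_close omega (n := 0)) => J a; apply/forces_and; split.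
- apply: (forces_ex_intro (x := empty J)).
  rewrite forces_and forces_empty forces_mem ev_omega !evE -num_zero_at.
  by split=> //; exact: mem_omega_num.
- apply/forces_allin => I q x hx; apply: (forces_ex_intro (x := succ x)).
  rewrite forces_and forces_succ forces_mem ev_omega !evE.
  rewrite -ev_comp ev_omega in hx.
  by split=> //; exact: mem_omega_succ.
Qed.

(** The subobject of [J × N] where the formula holds of the numeral is closed
    under zero and successor. *)
Lemma valid_infinity2 n (p : form (Datatypes.S n)) : valid E omega (Infinity2 p).
Proof.
apply/valid_close => J0 a0; apply/forces_imp => J q0.
move: (a0 ∘ q0) => {a0 q0 J0} a /forces_and [h0 /forces_allin hS].
apply/forces_allin => I q x; rewrite -ev_comp ev_omega.
move/mem_omega => [K [d [m [cd em]]]].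
have key : factors (pair (q ∘ d) m)
    (sub_pull (extend (a ∘ pr1) (num ∘ pr2)) (interp E omega p)).
  have T_at L (r : hom L J) k : factors (pair r k)
      (sub_pull (extend (a ∘ pr1) (num ∘ pr2)) (interp E omega p)) <->
      (extend (a ∘ r) (num ∘ k) ⊩ p).
    by rewrite factors_pull -/(forces omega _ _) extend_comp -!comp_assoc
      pr1_pair pr2_pair.
  apply: nat_induction => [|L r k].
    apply/T_at; rewrite comp_idr num_zero_at.
    move/forces_ex: h0 => [L [c [z [cc]]]].
    rewrite forces_and forces_empty !evE => [[-> hz]].
    by apply: (forces_descent cc); rewrite extend_comp empty_comp.
  move=> /T_at hk; apply/T_at; rewrite num_succ_at.
  have := hS L r (num ∘ k).
  rewrite -ev_comp ev_omega => /(_ (mem_omega_num _)).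
  move=> /forces_imp /(_ L (idm L)); rewrite comp_idr => /(_ hk).
  move=> /forces_ex [M [c [y [cc]]]].
  rewrite forces_and forces_succ !evE => [[-> hy]].
  apply: (forces_descent cc); rewrite extend_comp succ_comp.
  move: hy; apply forces_ren => i; rewrite /extend; pattern i.
  apply (Fin.caseS' i) => [|j] /=; first by rewrite !pr2_pair.
  by rewrite pair_comp -!comp_assoc !pr1_pair.
apply: (forces_descent cd); rewrite extend_comp -em -comp_assoc.
move: key; rewrite factors_pull -/(forces omega _ _) extend_comp -!comp_assoc.
by rewrite pr1_pair pr2_pair.
Qed.

End Infinity.

Lemma numerals_exist : exists num : hom (nat_obj N) V,
  num ∘ nat_zero N = empty one /\ num ∘ nat_succ N = succ num.
Proof.
have [h [[h1 h2] _]] := nat_rec N (empty one : hom one V) (succ pr2 : hom (prod one V) V).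
exists (h ∘ pair (bang _) (idm _)); split.
- rewrite -comp_assoc pair_comp comp_idl -h1; congr (_ ∘ pair _ _).
    exact: bang_eq.
  by rewrite (bang_eq (bang one) (idm one)) comp_idr.
- have -> : h ∘ pair (bang _) (idm _) ∘ nat_succ N =
      h ∘ pmap (idm one) (nat_succ N) ∘ pair (bang _) (idm _).
    rewrite -!comp_assoc pmap_pair pair_comp comp_idl comp_idr comp_idl.
    by congr (_ ∘ pair _ _); exact: bang_eq.
  by rewrite h2 !succ_comp pr2_pair.
Qed.

End Universe.

Theorem proposition4p2 (C : heyting_pretopos) (N : nno C) (S : small_maps N)
    (V : C) (E : hom V (Ps S V)) (HE : indexed_final_coalgebra E) :
  exists w : hom one V, is_model E w CZF0_AFA.
Proof.
have [F [EF FE]] := final_coalgebra_iso HE.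
have [num [num0 numS]] := numerals_exist EF FE.
exists (omega F num) => p; case=> [{}p|]; last first.
  exact (valid_AFA EF FE _ (final_decoration HE)).
case=> [|||||n q||n q].
- exact (valid_extensionality FE _).
- exact (valid_pairing EF FE _).
- exact (valid_union EF FE _).
- exact (valid_emptyset EF FE _).
- exact (valid_intersection EF FE _).
- exact (valid_replacement EF FE _ q).
- exact (valid_infinity1 EF FE num0 numS).
- exact (valid_infinity2 EF FE num0 numS q).
Qed.
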